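(* Let $K\subset\mathbb{R}^n$ be a regular cone and $F$ a $\vartheta$-LHSCB for $K$. Then for every pair $x\in\operatorname{int}(K)$, $s\in\operatorname{int}(K^* )$, $$\frac{\lambda_{\max}^{1/2}\big(F''(x)F_*''(s)\big)}{\delta_F(x,s)}\le 2+\frac{2(\vartheta-1)}{\vartheta(\mu\tilde\mu-1)+1}=2+\frac{2(\vartheta-1)}{\gamma_{\mathrm G}(x,s)+1}.$$ Therefore $\check\xi_F\le 2\vartheta$. Moreover, every pair $(x,s)\in\operatorname{int}(K)\oplus\operatorname{int}(K^* )$ for which $\mu\tilde\mu\ge 2$ satisfies $$\frac{\lambda_{\max}^{1/2}\big(F''(x)F_*''(s)\big)}{\delta_F(x,s)}\le 4.$$
   Context: A cone $K\subset\mathbb{R}^n$ is regular if it is a pointed, closed, convex cone with nonempty interior; its dual cone is $K^*=\{s\in\mathbb{R}^n:\langle s,x\rangle\ge 0\ \forall x\in K\}$. For symmetric matrices, $A\preceq B$ means $B-A$ is positive semidefinite; $\mathbb{S}^n_{++}$ is the set of symmetric positive definite matrices; $\lambda_{\max}$ is the largest eigenvalue. A $\vartheta$-logarithmically homogeneous self-concordant barrier ($\vartheta$-LHSCB) for $K$ is a closed convex function $F$ with domain $\operatorname{int}(K)$, three times continuously differentiable there, such that $F(tx)=F(x)-\vartheta\ln t$ for all $x\in\operatorname{int}(K)$, $t>0$, and $F'''(x;h)\preceq 2\|h\|_xF''(x)$ for all $x\in\operatorname{int}(K)$, $h\in\mathbb{R}^n$, where $\|h\|_x=\langle F''(x)h,h\rangle^{1/2}$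 and $F'''(x;h)=\frac{d}{d\alpha}F''(x+\alpha h)|_{\alpha=0}$. The dual barrier is $F_*(s)=\sup_{x\in\operatorname{int}(K)}\{-\langle s,x\rangle-F(x)\}$. For $x\in\operatorname{int}(K)$, $s\in\operatorname{int}(K^* )$ put $\mu=\langle s,x\rangle/\vartheta$, $\tilde\mu=\langle F'(x),F_*'(s)\rangle/\vartheta$, $\gamma_{\mathrm G}(x,s)=\vartheta(\mu\tilde\mu-1)$ (which is always $\ge 0$), and $\delta_F(x,s)=(\gamma_{\mathrm G}(x,s)+1)/\mu$. For $\xi>0$ let $\check{\mathcal T}(x,s;\xi)=\{T\in\mathbb{S}^n_{++}:\frac{1}{\xi\delta_F(x,s)}F''(x)\preceq T\preceq\xi\delta_F(x,s)F_*''(s)^{-1}\}$ and $\check\xi_F=\inf\{\xi:\check{\mathcal T}(x,s;\xi)\ne\emptyset\ \forall x\in\operatorname{int}(K),s\in\operatorname{int}(K^* )\}$; equivalently $\check\xi_F=\sup_{x,s}\lambda_{\max}^{1/2}(F''(x)F_*''(s))/\delta_F(x,s)$. *)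

(* Defs.v *)
From HB Require Import structures.
From mathcomp Require Import all_boot all_order all_algebra.
From mathcomp Require Import all_classical all_reals all_analysis.

Set Implicit Arguments.
Unset Strict Implicit.
Unset Printing Implicit Defensive.

Import Order.TTheory GRing.Theory Num.Theory.
Import numFieldNormedType.Exports.

Local Open Scope classical_set_scope.
Local Open Scope ring_scope.

(* Vectors of R^n are row vectors. *)
Definition dot (R : realType) (n : nat) (u v : 'rV[R]_n) : R :=
  (u *m v^T) 0 0.

Definition psd (R : realType) (n : nat) (A : 'M[R]_n) : Prop :=
  A^T = A /\ forall v : 'rV[R]_n, 0 <= dot (v *m A) v.

Definition posdef (R : realType) (n : nat) (A : 'M[R]_n) : Prop :=
  A^T = A /\ forall v : 'rV[R]_n, v != 0 -> 0 < dot (v *m A) v.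

Definition loewner_le (R : realType) (n : nat) (A B : 'M[R]_n) : Prop :=
  psd (B - A).

(* Only real eigenvalues are considered: this is the largest eigenvalue for
   matrices with real spectrum, such as a product of two symmetric positive
   definite matrices. *)
Definition lambda_max (R : realType) (n : nat) (A : 'M[R]_n) : R :=
  sup [set a | eigenvalue A a].

Definition gradient (R : realType) (n : nat) (f : 'rV[R]_n -> R)
    (x : 'rV[R]_n) : 'rV[R]_n :=
  \row_i 'D_(delta_mx 0 i) f x.

Definition hessian (R : realType) (n : nat) (f : 'rV[R]_n -> R)
    (x : 'rV[R]_n) : 'M[R]_n :=
  \matrix_(i, j) 'D_(delta_mx 0 i) ('D_(delta_mx 0 j) f) x.

(* F'''(x; h), the matrix d/da F''(x + a h) at a = 0. *)
Definition third_derivative (R : realType) (n : nat) (f : 'rV[R]_n -> R)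
    (x h : 'rV[R]_n) : 'M[R]_n :=
  'D_h (hessian f) x.

Definition local_norm (R : realType) (n : nat) (f : 'rV[R]_n -> R)
    (x h : 'rV[R]_n) : R :=
  Num.sqrt (dot (h *m hessian f x) h).

(* f is k times continuously differentiable on U (U is open in all uses). *)
Fixpoint Ck_on (R : realType) (n : nat) (k : nat) (U : set 'rV[R]_n)
    (f : 'rV[R]_n -> R) : Prop :=
  match k with
  | 0 => forall x, U x -> {for x, continuous f}
  | k'.+1 => (forall x, U x -> differentiable f x) /\
             forall v : 'rV[R]_n, Ck_on k' U ('D_v f)
  end.

Record regular_cone (R : realType) (n : nat) (K : set 'rV[R]_n) : Prop := {
  regular_cone_scale : forall (t : R) x, 0 <= t -> K x -> K (t *: x);
  regular_cone_convex : convex_set K;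
  regular_cone_closed : closed K;
  regular_cone_pointed : forall x, K x -> K (- x) -> x = 0;
  regular_cone_interior : interior K !=set0
}.

Definition dual_cone (R : realType) (n : nat) (K : set 'rV[R]_n) :
    set 'rV[R]_n :=
  [set s | forall x, K x -> 0 <= dot s x].

(* The barrier has domain int(K): the values of F outside int(K) are never
   used and stand for +oo.  Closedness is closedness of the epigraph. *)
Record LHSCB (R : realType) (n : nat) (K : set 'rV[R]_n) (theta : R)
    (F : 'rV[R]_n -> R) : Prop := {
  LHSCB_convex : convex_function (interior K) F;
  LHSCB_closed :
    closed [set p : 'rV[R]_n * R | interior K p.1 /\ F p.1 <= p.2];
  LHSCB_C3 : Ck_on 3 (interior K) F;
  LHSCB_log_homogeneous : forall x (t : R), interior K x -> 0 < t ->
    F (t *: x) = F x - theta * ln t;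
  LHSCB_self_concordant : forall x h, interior K x ->
    loewner_le (third_derivative F x h)
               ((2 * local_norm F x h) *: hessian F x)
}.

(* A real supremum, equal by convention to 0 when it is infinite; it is finite
   for s in the open set int(K^* ), where alone it is evaluated and
   differentiated. *)
Definition dual_barrier (R : realType) (n : nat) (K : set 'rV[R]_n)
    (F : 'rV[R]_n -> R) (s : 'rV[R]_n) : R :=
  sup [set - dot s x - F x | x in interior K].

Definition mu (R : realType) (n : nat) (theta : R) (x s : 'rV[R]_n) : R :=
  dot s x / theta.

Definition mu_tilde (R : realType) (n : nat) (K : set 'rV[R]_n) (theta : R)
    (F : 'rV[R]_n -> R) (x s : 'rV[R]_n) : R :=
  dot (gradient F x) (gradient (dual_barrier K F) s) / theta.

Definition gammaG (R : realType) (n : nat) (K : set 'rV[R]_n) (theta : R)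
    (F : 'rV[R]_n -> R) (x s : 'rV[R]_n) : R :=
  theta * (mu theta x s * mu_tilde K theta F x s - 1).

Definition deltaF (R : realType) (n : nat) (K : set 'rV[R]_n) (theta : R)
    (F : 'rV[R]_n -> R) (x s : 'rV[R]_n) : R :=
  (gammaG K theta F x s + 1) / mu theta x s.

Definition T_check (R : realType) (n : nat) (K : set 'rV[R]_n) (theta : R)
    (F : 'rV[R]_n -> R) (x s : 'rV[R]_n) (xi : R) : set 'M[R]_n :=
  [set T | [/\ posdef T,
     loewner_le ((1 / (xi * deltaF K theta F x s)) *: hessian F x) T &
     loewner_le T ((xi * deltaF K theta F x s) *:
                   invmx (hessian (dual_barrier K F) s))]].

(* The infimum is taken in the extended reals, so it is +oo if no xi is
   feasible. *)
Definition xi_check (R : realType) (n : nat) (K : set 'rV[R]_n) (theta : R)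
    (F : 'rV[R]_n -> R) : \bar R :=
  ereal_inf [set xi%:E | xi in [set xi : R | 0 < xi /\
    forall x s, interior K x -> interior (dual_cone K) s ->
      T_check K theta F x s xi !=set0]].

(* Main.v *)
Require Import Defs.
From HB Require Import structures.
From mathcomp Require Import all_boot all_order all_algebra.
From mathcomp Require Import all_classical all_reals all_analysis.
From mathcomp Require Import ring lra.

Import Order.TTheory GRing.Theory Num.Theory.
Import numFieldNormedType.Exports.

Local Open Scope classical_set_scope.
Local Open Scope ring_scope.

(* Let u = -F_*'(s), the maximizer defining F_*(s), so that F'(u) = -s and
   F_*''(s) is the inverse of F''(u).  If |h|_u < 1 then u + h and u - h lie in
   K (Dikin ellipsoid), and |z|_x <= -<F'(x), z> for every z in K; adding the
   two resulting inequalities gives |h|_x <= -<F'(x), u> = theta * mu~.  Hence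
   lambda_max^(1/2) <= theta * mu~, and dividing by delta_F gives
   theta mu mu~ / (theta (mu mu~ - 1) + 1), which is half of the claimed bound.
   Homogeneity makes F'''(x; x) = -2 F''(x), so self-concordance in the
   direction x already yields that F''(x) is symmetric and positive
   semidefinite. *)

(** * Calculus on lines *)

Section RealLine.
Context {R : realType}.
Implicit Types (f df phi dphi : R -> R) (t T e k : R).

(** The hypotheses do not state strict convexity, and [dual_barrier] is a bare supremum, so much of
    the work secures what the overview takes for granted. Until F'' is known to be nondegenerate,
    estimates along a line use q + e with e > 0, where q is the Hessian form of the direction; the
    Dikin ellipsoid and pointedness then give positive definiteness. The derivatives of F_* come
    from the minimizer u of <s, y> + F(y): it exists because <s, y> grows linearly while F decreases
    at most logarithmically, it is Lipschitz in s along lines, and linearizing F'(u) = -s gives its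
    derivative. The inequality |z|_x <= -<F'(x), z> is one-dimensional: along a ray in K the slope
    is never positive, while self-concordance keeps the local norm of z above a / (1 + t a), whose
    square integrates to a = |z|_x. For the bound on xi, the witness T is F''(u) scaled by 2 theta
    delta_F; it rests on mu mu~ >= 1 and theta >= 1. The latter fails in dimension 0, where theta =
    0. *)

Lemma derive_le_increment f df T k : 0 <= T ->
  (forall t, 0 <= t <= T -> is_derive t 1 f (df t)) ->
  (forall t, 0 <= t <= T -> df t <= k) -> f T - f 0 <= k * T.
Proof.
move=> T0 fdf dfk.
have [|c|c] := @MVT_segment R f df 0 T T0.
- by move=> x; rewrite in_itv/= => /andP[x0 xT]; apply: fdf; rewrite !ltW.
- apply: derivable_within_continuous => x; rewrite in_itv/= => xT.
  by apply: ex_derive; exact: fdf.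
by rewrite in_itv/= subr0 => cT ->; rewrite ler_wpM2r// dfk.
Qed.

Lemma derive_ge_increment f df T k : 0 <= T ->
  (forall t, 0 <= t <= T -> is_derive t 1 f (df t)) ->
  (forall t, 0 <= t <= T -> k <= df t) -> k * T <= f T - f 0.
Proof.
move=> T0 fdf kdf.
rewrite -lerN2 -mulNr opprB.
have := @derive_le_increment (- f) (- df) T (- k) T0.
rewrite /= !fctE opprK addrC; apply.
  by move=> t /fdf ?; exact: is_deriveN.
by move=> t /kdf; rewrite lerN2.
Qed.

(** The derivative of (phi + e)^(-1/2) is -phi' / (2 (phi + e)^(3/2)), of absolute value at most
    (phi / (phi + e))^(3/2) <= 1. The shift [e] admits a [phi] that vanishes; [e] = 0 serves once
    [phi] is known to be positive. *)
Lemma rsqrt_lipschitz phi dphi T e : 0 <= T -> 0 <= e ->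
  (forall t, 0 <= t <= T -> [/\ is_derive t 1 phi (dphi t), 0 <= phi t,
     0 < phi t + e & `|dphi t| <= 2 * phi t * Num.sqrt (phi t)]) ->
  `|(Num.sqrt (phi T + e))^-1 - (Num.sqrt (phi 0 + e))^-1| <= T.
Proof.
move=> T0 e0 H.
pose q t := Num.sqrt (phi t + e).
pose dpsi t := - (q t) ^- 2 * ((2 * q t)^-1 * dphi t).
have D t : 0 <= t <= T -> is_derive t 1 (fun t => (q t)^-1) (dpsi t).
  move=> /H[dp p0 pe0 _].
  have qn0 : q t != 0 by rewrite /q gt_eqF// sqrtr_gt0.
  apply: is_deriveV => //.
  have dpe : is_derive t 1 (phi + cst e) (dphi t).
    by apply: is_derive_eq; rewrite addr0.
  exact: (@is_derive1_comp R Num.sqrt (phi + cst e) t _ _ (is_derive1_sqrt pe0) dpe).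
have B t : 0 <= t <= T -> `|dpsi t| <= 1.
  move=> /H[dp p0 pe0 Hd].
  have q0 : 0 < q t by rewrite /q sqrtr_gt0.
  have q2 : q t ^+ 2 = phi t + e by rewrite sqr_sqrtr// ltW.
  rewrite /dpsi mulrA mulNr -invfM normrM normrN (@ger0_norm _ _^-1); last first.
    by rewrite invr_ge0 mulr_ge0 ?exprn_ge0 ?mulr_ge0 ?ltW.
  rewrite ler_pdivrMl ?mulr_gt0 ?exprn_gt0// mulr1.
  apply: le_trans Hd _.
  rewrite mulrA [_ * 2]mulrC ler_pM ?mulr_ge0 ?sqrtr_ge0//.
    by rewrite q2 ler_pM2l// lerDl.
  by rewrite /q ler_wsqrtr// lerDl.
have /= lo := derive_ge_increment _ _ _ (-1) T0 D.
have /= hi := derive_le_increment _ _ _ 1 T0 D.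
rewrite ler_norml -mulN1r lo/= => [|t /B]; last by rewrite ler_norml => /andP[].
by rewrite -[leRHS]mul1r hi// => t /B; rewrite ler_norml => /andP[].
Qed.

Lemma is_derive1_inv : is_derive (1 : R) 1 (@GRing.inv R) (-1).
Proof.
have D := @is_deriveV R id 1 1 1 (oner_neq0 _) (is_derive_id _ _).
by apply: is_derive_eq; rewrite /= expr1n invr1 /GRing.scale/= mulr1.
Qed.

End RealLine.

(** * Inner product and directional derivatives *)

Section DirectionalDerivatives.
Context {R : realType} {n : nat}.
Implicit Types (f : 'rV[R]_n -> R) (x h u v : 'rV[R]_n) (s t a : R).

Lemma dotE u v : dot u v = \sum_i u 0 i * v 0 i.
Proof. by rewrite /dot mxE; apply: eq_bigr => i _; rewrite mxE. Qed.

Lemma dotC u v : dot u v = dot v u.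
Proof. by rewrite !dotE; apply: eq_bigr => i _; rewrite mulrC. Qed.

Lemma dotDl u v h : dot (u + v) h = dot u h + dot v h.
Proof. by rewrite /dot mulmxDl mxE. Qed.

Lemma dotZl a u h : dot (a *: u) h = a * dot u h.
Proof. by rewrite /dot -scalemxAl mxE. Qed.

Lemma dotNl u h : dot (- u) h = - dot u h.
Proof. by rewrite -scaleN1r dotZl mulN1r. Qed.

Lemma dotBl u v h : dot (u - v) h = dot u h - dot v h.
Proof. by rewrite dotDl dotNl. Qed.

Lemma dot0l h : dot 0 h = 0.
Proof. by rewrite /dot mul0mx mxE. Qed.

Lemma dotDr u v h : dot h (u + v) = dot h u + dot h v.
Proof. by rewrite !(dotC h) dotDl. Qed.

Lemma dotZr a u h : dot h (a *: u) = a * dot h u.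
Proof. by rewrite !(dotC h) dotZl. Qed.

Lemma dotNr u h : dot h (- u) = - dot h u.
Proof. by rewrite !(dotC h) dotNl. Qed.

Lemma dotBr u v h : dot h (u - v) = dot h u - dot h v.
Proof. by rewrite !(dotC h) dotBl. Qed.

Lemma dot0r h : dot h 0 = 0.
Proof. by rewrite dotC dot0l. Qed.

Lemma dot_delta u i : dot u (delta_mx 0 i) = u 0 i.
Proof.
rewrite dotE (bigD1 i)//= big1 ?addr0; first by rewrite mxE !eqxx mulr1.
by move=> j ji; rewrite mxE eqxx (negbTE ji) mulr0.
Qed.

Lemma dot_mulmxC (A : 'M[R]_n) u v : A^T = A -> dot (u *m A) v = dot (v *m A) u.
Proof. by move=> AT; rewrite dotC /dot trmx_mul AT mulmxA. Qed.

Lemma differentiable_dot u x : differentiable (dot u) x.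
Proof.
have -> : dot u = \sum_(i < n) (u 0 i *: (fun y : 'rV[R]_n => y 0 i : R)).
  by apply/funext => y; rewrite dotE fct_sumE.
by apply: differentiable_sum => i; exact/differentiableZ/differentiable_coord.
Qed.

Lemma continuous_dot u : continuous (dot u).
Proof. by move=> x; exact/differentiable_continuous/differentiable_dot. Qed.

Lemma is_derive_line f x h t : derivable f (x + t *: h) h ->
  is_derive t 1 (fun s => f (x + s *: h)) ('D_h f (x + t *: h)).
Proof.
move=> df.
have E : (fun s => s^-1 *: (((fun s => f (x + s *: h)) \o shift t) (s *: 1) -
      f (x + t *: h))) =
    (fun s => s^-1 *: ((f \o shift (x + t *: h)) (s *: h) - f (x + t *: h))).
  apply/funext => s /=; congr (_ *: (f _ - _)).
  by rewrite [s%:A]mulr1 scalerDl addrCA.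
by split; rewrite /derivable /derive E.
Qed.

Lemma derive_linear f x a u v : differentiable f x ->
  'D_(a *: u + v) f x = a * 'D_u f x + 'D_v f x.
Proof. by move=> df; rewrite !deriveE// linearP. Qed.

Lemma derive_scale f x a u : differentiable f x -> 'D_(a *: u) f x = a * 'D_u f x.
Proof. by move=> df; rewrite !deriveE// linearZ. Qed.

Lemma derive_gradient f x h : differentiable f x -> 'D_h f x = dot (gradient f x) h.
Proof.
move=> df; rewrite {1}[h]row_sum_delta deriveE// linear_sum/= dotE.
by apply: eq_bigr => i _; rewrite linearZ/= !mxE deriveE// mulrC.
Qed.

End DirectionalDerivatives.

(** * Scaling of derivatives and Euler identities *)

Section Homogeneity.
Context {R : realType} {n : nat} {U : set 'rV[R]_n} {f : 'rV[R]_n -> R}.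
Context {a b : R -> R}.
Context (oU : open U) (dfU : forall x, U x -> differentiable f x).
Context (hom : forall x t, U x -> 0 < t -> f (t *: x) = a t * f x + b t).
Implicit Types (x h : 'rV[R]_n) (t : R).

Lemma near_line x h : U x -> \forall s \near (0 : R), U (x + s *: h).
Proof.
move=> Ux; have : x + s *: h @[s --> (0 : R)] --> x + 0 *: h.
  by apply: cvgD; [exact: cvg_cst|apply: cvgZr_tmp; exact: cvg_id].
rewrite scale0r addr0; by apply; exact: open_nbhs_nbhs.
Qed.

(** Differentiating f (t (x + s h)) = a t f (x + s h) + b t in s at 0 gives the factor [a t / t].
    The form with [a] and [b] covers F (a = 1, b = - theta ln) as well as its first and second
    derivatives (b = 0). *)
Lemma derive_hom x h t : U x -> U (t *: x) -> 0 < t ->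
  'D_h f (t *: x) = a t / t * 'D_h f x.
Proof.
move=> Ux Utx t0.
apply: (mulfI (lt0r_neq0 t0)); rewrite -(derive_scale _ (t *: x)); last exact: dfU.
rewrite mulrA mulrCA divff ?gt_eqF// mulr1.
have D1 : is_derive (0 : R) 1 (fun s => f (t *: x + s *: (t *: h)))
    ('D_(t *: h) f (t *: x)).
  have := @is_derive_line _ _ f (t *: x) (t *: h) 0.
  by rewrite scale0r addr0; apply; apply: diff_derivable; exact: dfU.
have D2 : is_derive (0 : R) 1 (fun s => f (x + s *: h)) ('D_h f x).
  have := @is_derive_line _ _ f x h 0.
  by rewrite scale0r addr0; apply; apply: diff_derivable; exact: dfU.
have D3 : is_derive (0 : R) 1 (a t *: (fun s => f (x + s *: h)) + cst (b t))
    (a t * 'D_h f x).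
  by apply: is_derive_eq; rewrite addr0.
rewrite -(@derive_val _ _ _ _ _ _ _ D1) -(@derive_val _ _ _ _ _ _ _ D3).
apply: near_eq_derive; near=> s.
rewrite scalerA mulrC -scalerA -scalerDr hom//=.
by near: s; exact: near_line.
Unshelve. all: by end_near. Qed.

Lemma derive_euler x da db : U x -> is_derive (1 : R) 1 a da ->
  is_derive (1 : R) 1 b db -> 'D_x f x = da * f x + db.
Proof.
move=> Ux Da Db.
have D1 : is_derive (0 : R) 1 (fun s => f (x + s *: x)) ('D_x f x).
  have := @is_derive_line _ _ f x x 0.
  by rewrite scale0r addr0; apply; apply: diff_derivable; exact: dfU.
have sh (c : R -> R) dc : is_derive (1 : R) 1 c dc ->
    is_derive (0 : R) 1 (c \o (cst 1 + id)) (dc * 1).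
  move=> Dc; apply: is_derive1_comp; first by rewrite !fctE /= addr0.
  by apply: is_derive_eq; rewrite add0r.
have D3 : is_derive (0 : R) 1
   (f x *: (a \o (cst 1 + id)) + (b \o (cst 1 + id))) (f x * (da * 1) + db * 1).
  by have := sh _ _ Da; have := sh _ _ Db => ? ?; exact: is_deriveD.
rewrite -(@derive_val _ _ _ _ _ _ _ D1) mulrC -[da]mulr1 -[db]mulr1.
rewrite -(@derive_val _ _ _ _ _ _ _ D3).
apply: near_eq_derive; near=> s.
rewrite -[X in X + _]scale1r -scalerDl hom//=.
  by rewrite /= mulrC.
suff : -1 < s by rewrite -subr_gt0 opprK addrC.
by near: s; apply: lt_nbhsr; rewrite ltrN10.
Unshelve. all: by end_near. Qed.

End Homogeneity.

(** * Cones and barriers *)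

Section Cone.
Context {R : realType} {n : nat} {K : set 'rV[R]_n} (hK : regular_cone K).
Implicit Types (x y z h s : 'rV[R]_n) (t : R).

Lemma cone_add x y : K x -> K y -> K (x + y).
Proof.
move=> Kx Ky.
have h0 : (0 : R) <= 2^-1 by rewrite invr_ge0.
have h1 : 2^-1 <= (1 : R) by rewrite invf_le1// ler1n.
have /set_mem := regular_cone_convex hK (Itv01 h0 h1) (mem_set Kx) (mem_set Ky).
move=> /(regular_cone_scale hK (ler0n _ 2)).
rewrite /conv/= scalerDr !scalerA.
have h2 : 2 * 2^-1 = 1 :> R by rewrite divff.
by rewrite mulrBr h2 mulr1 (_ : 2 - 1 = 1) ?scale1r; last lra.
Qed.

Lemma interior_cone_scale x t : interior K x -> 0 < t -> interior K (t *: x).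
Proof.
move=> Kx t0; rewrite /interior.
have c : t^-1 *: y @[y --> t *: x] --> x.
  have := @scaler_continuous _ _ t^-1 (t *: x).
  by rewrite /continuous_at scalerA mulVf ?gt_eqF// scale1r.
have Kc : \forall y \near t *: x, K (t^-1 *: y) by exact: (c _ Kx).
apply: filterS Kc => y /(regular_cone_scale hK (ltW t0)).
by rewrite scalerA divff ?gt_eqF// scale1r.
Qed.

Lemma interior_cone_add x z : interior K x -> K z -> interior K (x + z).
Proof.
move=> Kx Kz; rewrite /interior.
have c : y - z @[y --> x + z] --> x.
  have : y - z @[y --> x + z] --> (x + z) - z.
    by apply: (@cvgB _ _ _ (nbhs (x + z)) _ id (cst z)); [exact: cvg_id|exact: cvg_cst].
  by rewrite addrK.
have Kc : \forall y \near x + z, K (y - z) by exact: (c _ Kx).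
by apply: filterS Kc => y /cone_add/(_ Kz); rewrite subrK.
Qed.

Lemma interior_cone_ray x h t : interior K x -> K h -> 0 <= t ->
  interior K (x + t *: h).
Proof.
by move=> Kx Kh t0; apply: interior_cone_add => //; exact: regular_cone_scale.
Qed.

Lemma interior_cone_segment x h t : interior K x -> interior K (x + h) ->
  0 <= t <= 1 -> interior K (x + t *: h).
Proof.
move=> Kx Kxh /andP[]; rewrite le_eqVlt => /predU1P[<-|t0 t1].
  by rewrite scale0r addr0.
have -> : x + t *: h = t *: (x + h) + (1 - t) *: x.
  by rewrite scalerDr scalerBl scale1r [RHS]addrC addrA subrK.
apply: interior_cone_add; first exact: interior_cone_scale.
by apply: (regular_cone_scale hK); [rewrite subr_ge0|exact: interior_subset].
Qed.

Lemma open_interior_cone_sub x h : interior K x ->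
  exists2 e, 0 < e & K (x - e *: h).
Proof.
move=> Kx.
have := @near_line _ _ _ (@open_interior _ K) x (- h) Kx => /nbhs_ballP[e /= e0].
move=> /(_ (e / 2)); rewrite /ball/= sub0r normrN gtr0_norm ?divr_gt0//.
rewrite ltr_pdivrMr// ltr_pMr// ltr1n => /(_ isT) Ke.
by exists (e / 2); [rewrite divr_gt0|rewrite -scalerN; exact: interior_subset].
Qed.

(** A neighbourhood of 0 inside K would contain small multiples of the all-ones vector and of its
    opposite, against pointedness. *)
Lemma interior_cone_neq0 x : (0 < n)%N -> interior K x -> x != 0.
Proof.
move=> n0 Kx; apply/eqP => x0; rewrite {}x0 in Kx.
have cst0 : const_mx 1 = 0 :> 'rV[R]_n.
  have [e e0] := open_interior_cone_sub 0 (const_mx 1) Kx.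
  have [d d0] := open_interior_cone_sub 0 (- const_mx 1) Kx.
  rewrite !sub0r scalerN opprK.
  move=> /(regular_cone_scale hK (ltW (_ : 0 < d^-1)) ) Kd.
  move=> /(regular_cone_scale hK (ltW (_ : 0 < e^-1)) ) Ke.
  move: Kd Ke; rewrite !invr_gt0 !scalerN !scalerA !mulVf ?gt_eqF// !scale1r.
  by move=> /(_ d0) K1 /(_ e0) K2; exact: (regular_cone_pointed hK).
have := congr1 (fun v : 'rV[R]_n => v 0 (Ordinal n0)) cst0.
by rewrite !mxE => /eqP; rewrite oner_eq0.
Qed.

(** If the ball of radius e around s lies in the dual cone, then so do the points s -+ (e/2) e_i;
    pairing them with y bounds every |y_i|, hence the sup norm of y. *)
Lemma dual_cone_coercive s : interior (dual_cone K) s ->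
  exists2 c, 0 < c & forall y, K y -> c * `|y| <= dot s y.
Proof.
move=> /nbhs_ballP[e /= e0 eK]; exists (e / 2); first by rewrite divr_gt0.
have e2 : 0 < e / 2 by rewrite divr_gt0.
have coord (b : R) i y : `|b| = 1 -> K y -> e / 2 * (b * y 0 i) <= dot s y.
  move=> b1 Ky.
  have := eK (s - (e / 2 * b) *: delta_mx 0 i).
  rewrite -ball_normE/= opprB addrCA subrr addr0 normrZ normrM b1 mulr1 gtr0_norm//.
  have d1 : `|delta_mx 0 i : 'rV[R]_n| <= 1.
    rewrite {1}/Num.norm/= mx_normrE; apply: bigmax_le => // -[j k] _ /=.
    by rewrite mxE; case: (_ && _); rewrite ?normr1 ?normr0.
  have lt : e / 2 * `|delta_mx 0 i : 'rV[R]_n| < e.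
    apply: (le_lt_trans (ler_piMr (ltW e2) d1)).
    by rewrite ltr_pdivrMr// ltr_pMr// ltr1n.
  move=> /(_ lt) /(_ y Ky).
  by rewrite dotBl dotZl (dotC (delta_mx _ _)) dot_delta subr_ge0 mulrA.
move=> y Ky.
rewrite -ler_pdivlMl//.
rewrite {1}/Num.norm/= mx_normrE; apply: bigmax_le => [|[j i] _ /=].
  rewrite mulr_ge0 ?invr_ge0 ?(ltW e2)//.
  by apply: (eK s) => //; exact: ballxx.
rewrite ord1 ler_pdivlMl//.
have [y0|y0] := leP 0 (y 0 i).
  by rewrite ger0_norm// -[y 0 i]mul1r coord// normr1.
by rewrite ltr0_norm// -mulN1r coord// normrN normr1.
Qed.

End Cone.

(** * Derivatives of the barrier *)

Section BarrierDerivatives.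
Context {R : realType} {n : nat} {K : set 'rV[R]_n} {theta : R} {F : 'rV[R]_n -> R}.
Context (hK : regular_cone K) (hF : LHSCB K theta F).
Implicit Types (x y z h s u v w : 'rV[R]_n) (t : R).

Lemma barrier_differentiable x : interior K x -> differentiable F x.
Proof. by move: x; have [] := LHSCB_C3 hF. Qed.

Lemma barrier_differentiable2 v x : interior K x -> differentiable ('D_v F) x.
Proof. by move: x; have [_ /(_ v)[]] := LHSCB_C3 hF. Qed.

Lemma barrier_differentiable3 u v x : interior K x ->
  differentiable ('D_u ('D_v F)) x.
Proof. by move: x; have [_ /(_ v)[_ /(_ u)[]]] := LHSCB_C3 hF. Qed.

Lemma near_interior x (P : 'rV[R]_n -> Prop) : interior K x ->
  (forall y, interior K y -> P y) -> \near x, P x.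
Proof.
by move=> Kx KP; apply: filterS KP _; apply: open_nbhs_nbhs; split => //; exact: open_interior.
Qed.

Lemma hessian_form u v x : interior K x ->
  dot (u *m hessian F x) v = 'D_u ('D_v F) x.
Proof.
move=> Kx.
have E : \near x, 'D_v F x =
    (\sum_(j < n) (v 0 j *: 'D_(delta_mx 0 j) F)) x.
  apply: near_interior Kx _ => y Ky.
  rewrite derive_gradient; last exact: barrier_differentiable.
  by rewrite dotE fct_sumE; apply: eq_bigr => j _; rewrite mxE mulrC.
rewrite (near_eq_derive _ E) derive_sum => [|j]; last first.
  by apply: derivableZ; apply: diff_derivable; exact: barrier_differentiable2.
rewrite dotE; apply: eq_bigr => j _.
rewrite deriveZ; last by apply: diff_derivable; exact: barrier_differentiable2.
rewrite derive_gradient; last exact: barrier_differentiable2.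
by rewrite mxE dotE mulrC; congr (_ * _); apply: eq_bigr => i _; rewrite !mxE mulrC.
Qed.

Lemma hessian_derivable x h : interior K x -> derivable (hessian F) x h.
Proof.
move=> Kx; apply/derivable_mxP => i j.
under eq_fun do rewrite mxE.
by apply: diff_derivable; exact: barrier_differentiable3.
Qed.

Lemma third_derivative_form v h x : interior K x ->
  dot (v *m third_derivative F x h) v = 'D_h ('D_v ('D_v F)) x.
Proof.
move=> Kx.
have D i j : is_derive x h (fun y => hessian F y i j) (third_derivative F x h i j).
  rewrite /third_derivative derive_mx; last exact: hessian_derivable.
  by rewrite mxE; apply: derivableP; move: i j; apply/derivable_mxP; exact: hessian_derivable.
have E : \near x, (\sum_(j < n) (v 0 j *: \sum_(i < n) (v 0 i *: (fun y => hessian F y i j)))) x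
   = 'D_v ('D_v F) x.
  apply: near_interior Kx _ => y Ky.
  rewrite -hessian_form// dotE fct_sumE; apply: eq_bigr => j _.
  by rewrite mxE mulrC /GRing.scale/= fct_sumE; congr (_ * _).
rewrite -(near_eq_derive _ E) derive_val dotE; apply: eq_bigr => j _.
by rewrite mxE mulrC.
Qed.

Lemma barrier_derive_scale x h t : interior K x -> 0 < t ->
  'D_h F (t *: x) = t^-1 * 'D_h F x.
Proof.
move=> Kx t0.
rewrite (@derive_hom _ _ (interior K) F (cst 1) (fun t => - (theta * ln t)))//.
- by rewrite mul1r.
- exact: open_interior.
- exact: barrier_differentiable.
- by move=> y s Ky s0; rewrite (LHSCB_log_homogeneous hF)// mul1r.
- exact: interior_cone_scale.
Qed.

Lemma barrier_derive2_scale u v x t : interior K x -> 0 < t ->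
  'D_u ('D_v F) (t *: x) = t^-1 * t^-1 * 'D_u ('D_v F) x.
Proof.
move=> Kx t0.
rewrite (@derive_hom _ _ (interior K) ('D_v F) (@GRing.inv R) (cst 0))//.
- exact: open_interior.
- exact: barrier_differentiable2.
- by move=> y s Ky s0; rewrite barrier_derive_scale// addr0.
- exact: interior_cone_scale.
Qed.

Let Dc (c : R) : is_derive (1 : R) 1 (cst c : R -> R) 0.
Proof. exact: is_derive_cst. Qed.

Lemma gradient_euler x : interior K x -> dot (gradient F x) x = - theta.
Proof.
move=> Kx; rewrite -derive_gradient; last exact: barrier_differentiable.
have D : is_derive (1 : R) 1 (- (theta *: @ln R)) (- theta).
  have ? := @is_derive1_ln _ (1 : R) ltr01.
  by apply: is_derive_eq; rewrite invr1 /GRing.scale/= mulr1.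
rewrite (derive_euler barrier_differentiable _ _ _ _ Kx (Dc 1) D).
  by rewrite mul0r add0r.
by move=> y s Ky s0; rewrite (LHSCB_log_homogeneous hF)// mul1r.
Qed.

Lemma hessian_euler x v : interior K x ->
  dot (x *m hessian F x) v = - dot (gradient F x) v.
Proof.
move=> Kx; rewrite hessian_form// -derive_gradient; last exact: barrier_differentiable.
rewrite (derive_euler (barrier_differentiable2 v) _ _ _ _ Kx is_derive1_inv (Dc 0)).
  by rewrite addr0 mulN1r.
by move=> y s Ky s0; rewrite barrier_derive_scale// addr0.
Qed.

Lemma third_derivative_euler x : interior K x ->
  third_derivative F x x = - 2 *: hessian F x.
Proof.
move=> Kx; apply/matrixP => i j.
rewrite /third_derivative derive_mx; last exact: hessian_derivable.
rewrite !mxE; under eq_fun do rewrite mxE.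
have D : is_derive (1 : R) 1 (@GRing.inv R * @GRing.inv R) (-2).
  have ? := is_derive1_inv.
  by apply: is_derive_eq; rewrite invr1 /GRing.scale/=; lra.
rewrite (derive_euler (barrier_differentiable3 _ _) _ _ _ _ Kx D (Dc 0)).
  by rewrite addr0.
by move=> y s Ky s0; rewrite barrier_derive2_scale// addr0.
Qed.

Lemma hessian_psd x : interior K x -> psd (hessian F x).
Proof.
move=> Kx.
have [sym pos] := LHSCB_self_concordant hF x Kx.
pose c := 2 * local_norm F x x + 2.
  have c0 : 0 < c by rewrite ltr_wpDl ?mulr_ge0 ?sqrtr_ge0.
have E : (2 * local_norm F x x) *: hessian F x - third_derivative F x x = c *: hessian F x.
  by rewrite third_derivative_euler// scaleNr opprK -scalerDl.
rewrite E in sym pos; split.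
  by move: sym; rewrite linearZ => /(scalerI (lt0r_neq0 c0)).
by move=> v; have := pos v; rewrite -scalemxAr dotZl pmulr_rge0.
Qed.

(** The defining inequality is one-sided; used in the directions h and -h, which have the same local
    norm, it bounds the absolute value. *)
Lemma self_concordance x h : interior K x ->
  `|'D_h ('D_h ('D_h F)) x| <=
    2 * 'D_h ('D_h F) x * Num.sqrt ('D_h ('D_h F) x).
Proof.
move=> Kx.
have sc k : 'D_k ('D_h ('D_h F)) x <= 2 * local_norm F x k * 'D_h ('D_h F) x.
  have [_ /(_ h)] := LHSCB_self_concordant hF k Kx.
  rewrite mulmxBr dotBl -scalemxAr dotZl.
  by rewrite third_derivative_form// hessian_form// subr_ge0.
have N : local_norm F x (- h) = local_norm F x h.
  by rewrite /local_norm mulNmx dotNl dotNr opprK.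
have H : local_norm F x h = Num.sqrt ('D_h ('D_h F) x).
  by rewrite /local_norm hessian_form.
have := sc h; have := sc (- h); rewrite N H -scaleN1r derive_scale; last first.
  exact: barrier_differentiable3.
by rewrite mulN1r ler_norml -!mulrA [_ * Num.sqrt _]mulrC lerNl => -> ->.
Qed.

End BarrierDerivatives.

(** * Dikin ellipsoid and local norms *)

Lemma sup_mem_closed (R : realType) (A C : set R) :
  A !=set0 -> has_ubound A -> A `<=` C -> closed C -> C (sup A).
Proof.
move=> A0 uA AC /closure_id ->.
by apply: (closureS AC); exact: closure_sup.
Qed.

Lemma psd_cauchy_schwarz (R : realType) n (A : 'M[R]_n) u v : psd A ->
  dot (u *m A) v ^+ 2 <= dot (u *m A) u * dot (v *m A) v.
Proof.
move=> [sA pA].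
have q t : 0 <= dot (u *m A) u + 2 * t * dot (u *m A) v + t ^+ 2 * dot (v *m A) v.
  have := pA (u + t *: v).
  rewrite mulmxDl -scalemxAl !(dotDl, dotDr, dotZl, dotZr) (dot_mulmxC _ v u sA).
  by congr (_ <= _); ring.
have := pA v; rewrite le_eqVlt => /predU1P[v0|v0].
  rewrite -v0 mulr0.
  suff -> : dot (u *m A) v = 0 by rewrite expr0n.
  apply/eqP/negPn/negP => b0.
  (* With v isotropic the quadratic in t is affine; this t gives it the value -1. *)
  have := q (- (dot (u *m A) u + 1) / (2 * dot (u *m A) v)).
  rewrite -v0 mulr0 addr0 (_ : dot (u *m A) u + _ = -1); last by field.
  by rewrite oppr_ge0 ler10.
have := q (- dot (u *m A) v / dot (v *m A) v).
rewrite -(pmulr_lge0 _ v0).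
have -> : (dot (u *m A) u + 2 * (- dot (u *m A) v / dot (v *m A) v) * dot (u *m A) v +
   (- dot (u *m A) v / dot (v *m A) v) ^+ 2 * dot (v *m A) v) * dot (v *m A) v =
   dot (u *m A) u * dot (v *m A) v - dot (u *m A) v ^+ 2.
  by field; exact: lt0r_neq0.
by rewrite subr_ge0.
Qed.

Lemma psd_triangle (R : realType) n (A : 'M[R]_n) u v : psd A ->
  Num.sqrt (dot ((u + v) *m A) (u + v)) <=
  Num.sqrt (dot (u *m A) u) + Num.sqrt (dot (v *m A) v).
Proof.
move=> pA; have CS := psd_cauchy_schwarz _ _ _ u v pA; have [sA p0] := pA.
rewrite -[leRHS]ger0_norm ?addr_ge0 ?sqrtr_ge0// -sqrtr_sqr ler_wsqrtr//.
rewrite sqrrD !sqr_sqrtr// mulmxDl !(dotDl, dotDr) (dot_mulmxC _ v u sA).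
suff : dot (u *m A) v <= Num.sqrt (dot (u *m A) u) * Num.sqrt (dot (v *m A) v) by lra.
rewrite -sqrtrM//; apply: le_trans (ler_norm _) _.
by rewrite -sqrtr_sqr ler_wsqrtr.
Qed.

Section BarrierGeometry.
Context {R : realType} {n : nat} {K : set 'rV[R]_n} {theta : R} {F : 'rV[R]_n -> R}.
Context (hK : regular_cone K) (hF : LHSCB K theta F).
Implicit Types (x y z h u v w : 'rV[R]_n) (t T e : R).

Local Notation q x h := (dot (h *m hessian F x) h).

Lemma hessian_scale x h t : q x (t *: h) = t ^+ 2 * q x h.
Proof. by rewrite -scalemxAl dotZl dotZr; ring. Qed.

Lemma is_derive_barrier_line x h t : interior K (x + t *: h) ->
  is_derive t 1 (fun s => F (x + s *: h)) ('D_h F (x + t *: h)).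
Proof.
move=> Kx; apply: is_derive_line; apply: diff_derivable.
exact: (barrier_differentiable hF).
Qed.

Lemma is_derive_slope_line x h t : interior K (x + t *: h) ->
  is_derive t 1 (fun s => 'D_h F (x + s *: h)) (q (x + t *: h) h).
Proof.
move=> Kx; rewrite (hessian_form hF _ _ _ Kx); apply: is_derive_line; apply: diff_derivable.
exact: (barrier_differentiable2 hF).
Qed.

Lemma self_concordant_line x h T e : 0 <= T -> 0 <= e ->
  (forall t, 0 <= t <= T -> interior K (x + t *: h)) ->
  (forall t, 0 <= t <= T -> 0 < q (x + t *: h) h + e) ->
  `|(Num.sqrt (q (x + T *: h) h + e))^-1 - (Num.sqrt (q x h + e))^-1| <= T.
Proof.
move=> T0 e0 KT qe.
have qE t : 0 <= t <= T -> 'D_h ('D_h F) (x + t *: h) = q (x + t *: h) h.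
  by move=> tT; rewrite (hessian_form hF)//; exact: KT.
have := rsqrt_lipschitz (fun t => 'D_h ('D_h F) (x + t *: h))
  (fun t => 'D_h ('D_h ('D_h F)) (x + t *: h)) T e T0 e0.
rewrite /= !qE ?T0 ?lexx// scale0r addr0; apply=> t tT.
have Kt := KT _ tT; split.
- apply: is_derive_line; apply: diff_derivable.
  exact: (barrier_differentiable3 hF).
- by rewrite qE//; apply: (hessian_psd hK hF _ Kt).2.
- by rewrite qE// qe.
- exact: (self_concordance hF).
Qed.

Lemma hessian_form_ge0 x h : interior K x -> 0 <= q x h.
Proof. by move=> Kx; apply: (hessian_psd hK hF _ Kx).2. Qed.

(** The function (q + e)^(-1/2) is 1-Lipschitz along the segment and starts at 1 + c with c > 0, so
    it stays above c for t <= 1. Thus q <= c^-2, and two integrations bound F independently of t. *)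
Lemma dikin_line_bounded x h : interior K x -> q x h < 1 ->
  exists M, forall t, 0 <= t <= 1 -> interior K (x + t *: h) ->
    F (x + t *: h) <= M.
Proof.
have aux (a X Y : R) : - a <= X - Y -> a <= 1 -> Y - 1 <= X by lra.
have aux1 (a : R) : a < 1 -> a + (1 - a) / 2 < 1 by lra.
move=> Kx q1; pose e := (1 - q x h) / 2.
have e0 : 0 < e by rewrite divr_gt0// subr_gt0.
have qx0 := hessian_form_ge0 x h Kx.
have qe1 : q x h + e < 1 by exact: aux1.
have qe0 : 0 < q x h + e by rewrite ltr_wpDl.
pose c := (Num.sqrt (q x h + e))^-1 - 1.
have c0 : 0 < c.
  by rewrite subr_gt0 invf_gt1 ?sqrtr_gt0// -[ltRHS]sqrtr1 ltr_sqrt.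
exists (F x + (`|'D_h F x| + c^-1 ^+ 2)) => t /andP[t0 t1] Kt.
have Ks s : 0 <= s <= t -> interior K (x + s *: h).
  move=> /andP[s0 st]; have [t00|tn0] := eqVneq t 0.
    have -> : s = 0 by apply/eqP; rewrite eq_le s0 andbT -t00.
    by rewrite scale0r addr0.
  have tp : 0 < t by rewrite lt_neqAle eq_sym tn0.
  have -> : s *: h = (s / t) *: (t *: h) by rewrite scalerA divfK.
  apply: (interior_cone_segment hK) => //.
  by rewrite divr_ge0// ler_pdivrMr// mul1r.
have qB s : 0 <= s <= t -> q (x + s *: h) h <= c^-1 ^+ 2.
  move=> /andP[s0 st].
  have Kr r : 0 <= r <= s -> interior K (x + r *: h).
    by move=> /andP[r0 rs]; apply: Ks; rewrite r0 (le_trans rs).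
  have qs0 r : 0 <= r <= s -> 0 < q (x + r *: h) h + e.
    by move=> rs; apply: ltr_wpDl e0; apply: hessian_form_ge0; exact: Kr.
  have := self_concordant_line x h s e s0 (ltW e0) Kr qs0.
  rewrite ler_norml => /andP[+ _] => le1.
  have qqs0 : 0 < q (x + s *: h) h + e by rewrite qs0// s0 lexx.
  have cs : c <= (Num.sqrt (q (x + s *: h) h + e))^-1.
    exact: aux le1 (le_trans st t1).
  have : Num.sqrt (q (x + s *: h) h + e) <= c^-1.
    by rewrite -[leLHS]invrK lef_pV2 ?posrE ?invr_gt0 ?sqrtr_gt0.
  rewrite -(@ler_pXn2r _ 2) ?nnegrE ?sqrtr_ge0 ?invr_ge0 ?(ltW c0)//.
  by rewrite sqr_sqrtr ?(ltW qqs0)//; apply: le_trans; rewrite lerDl (ltW e0).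
have slope s : 0 <= s <= t -> 'D_h F (x + s *: h) <= `|'D_h F x| + c^-1 ^+ 2.
  move=> /andP[s0 st].
  have := @derive_le_increment _ (fun r => 'D_h F (x + r *: h)) _ s (c^-1 ^+ 2) s0.
  move=> /(_ (fun r => q (x + r *: h) h)) /=; rewrite scale0r addr0 => H.
  have {H} : 'D_h F (x + s *: h) - 'D_h F x <= c^-1 ^+ 2 * s.
    apply: H => r /andP[r0 rs].
      by apply: is_derive_slope_line; apply: Ks; rewrite r0 (le_trans rs).
    by apply: qB; rewrite r0 (le_trans rs).
  rewrite lerBlDl => /le_trans; apply; apply: lerD; first exact: ler_norm.
  by rewrite ler_piMr ?exprn_ge0 ?invr_ge0 ?(ltW c0)// (le_trans st).
have := @derive_le_increment _ (fun r => F (x + r *: h)) _ t (`|'D_h F x| + c^-1 ^+ 2) t0.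
move=> /(_ (fun r => 'D_h F (x + r *: h))) /=; rewrite scale0r addr0 => H.
have {H} : F (x + t *: h) - F x <= (`|'D_h F x| + c^-1 ^+ 2) * t.
  by apply: H => // r rt; apply: is_derive_barrier_line; exact: Ks.
rewrite lerBlDl => /le_trans; apply; rewrite lerD2l.
by rewrite ler_piMr ?addr_ge0 ?exprn_ge0 ?invr_ge0 ?(ltW c0).
Qed.

(** Let s be the supremum of the t in [0, 1] with x + t h interior. As F is bounded at those points,
    closedness of the epigraph puts x + s h in the interior too; if s < 1, openness gives a larger
    such t. *)
Lemma dikin_ellipsoid x h : interior K x -> q x h < 1 -> interior K (x + h).
Proof.
move=> Kx q1; have [M FM] := dikin_line_bounded x h Kx q1.
pose A := [set t : R | 0 <= t <= 1 /\ interior K (x + t *: h)].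
have A0 : A 0 by split; rewrite ?lexx ?ler01// scale0r addr0.
have uA : ubound A 1 by move=> t [/andP[]].
have hs : has_sup A by split; [exists 0|exists 1].
pose C := (fun t : R => (x + t *: h, M)) @^-1`
  [set p : 'rV[R]_n * R | interior K p.1 /\ F p.1 <= p.2].
have cC : closed C.
  apply: closed_comp; last exact: (LHSCB_closed hF).
  move=> t _; apply: (@cvg_pair _ _ _ _ (nbhs (x + t *: h)) (nbhs M)); last exact: cvg_cst.
  by apply: cvgD; [exact: cvg_cst|apply: cvgZr_tmp; exact: cvg_id].
have AC : A `<=` C by move=> t [t1 Kt]; split => //=; exact: FM.
have [Ks _] := sup_mem_closed _ A C hs.1 hs.2 AC cC.
have s0 : 0 <= sup A by apply: (sup_upper_bound hs).
have s1 : sup A <= 1 by exact: (ge_sup hs.1 uA).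
have ubs : ubound A (sup A) by exact: sup_upper_bound.
move: (sup A) ubs Ks s0 s1 => s ubs Ks s0; rewrite le_eqVlt => /predU1P[s1|s1].
  by move: Ks; rewrite s1 scale1r.
have /nbhs_ballP[e /= e0 eK] := @near_line _ _ _ (@open_interior _ K) _ h Ks.
have [d d0 /andP[de d1]] : exists2 d, 0 < d & (d < e) && (d <= 1 - s).
  exists (Num.min (e / 2) (1 - s)); first by rewrite lt_min divr_gt0//= subr_gt0.
  by rewrite gt_min ltr_pdivrMr// ltr_pMr// ltr1n/= ge_min lexx orbT.
have Ad : A (s + d).
  split; first by rewrite addr_ge0 ?(ltW d0)//= -lerBrDl.
  rewrite scalerDl addrA; apply: eK.
  by rewrite /ball/= sub0r normrN gtr0_norm.
by exfalso; have := ubs _ Ad; rewrite gerDl leNgt d0.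
Qed.

End BarrierGeometry.

(** * Positive definiteness of F'' and growth of slopes *)

Lemma rsqrt_lower_bound (R : realType) (b c t : R) : 0 < b -> 0 < c -> 0 <= t ->
  `|(Num.sqrt (b + 0))^-1 - (Num.sqrt (c + 0))^-1| <= t ->
  (Num.sqrt c / (1 + t * Num.sqrt c)) ^+ 2 <= b.
Proof.
move=> b0 c0 t0; rewrite !addr0 ler_norml lerBlDl => /andP[_ H].
have sb : 0 < Num.sqrt b by rewrite sqrtr_gt0.
have sc : 0 < Num.sqrt c by rewrite sqrtr_gt0.
have p : 0 < 1 + t * Num.sqrt c by rewrite ltr_pwDl// mulr_ge0// ltW.
have : Num.sqrt c / (1 + t * Num.sqrt c) <= Num.sqrt b.
  rewrite -[leRHS]invrK -[leLHS]invrK lef_pV2 ?posrE ?invr_gt0 ?divr_gt0//.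
  by apply: le_trans H _; rewrite invf_div mulrDl mul1r mulfK// gt_eqF.
rewrite -(@ler_pXn2r _ 2) ?nnegrE ?divr_ge0 ?(ltW sb) ?(ltW sc) ?(ltW p)//.
by rewrite sqr_sqrtr// ltW.
Qed.

Section BarrierInequalities.
Context {R : realType} {n : nat} {K : set 'rV[R]_n} {theta : R} {F : 'rV[R]_n -> R}.
Context (hK : regular_cone K) (hF : LHSCB K theta F).
Implicit Types (x y z h u v w : 'rV[R]_n) (t T e : R).

Local Notation q x h := (dot (h *m hessian F x) h).

(** By scaling, t (x + t^-1 h) = h + t x lies in K; let t tend to 0 from the right and use
    closedness. *)
Lemma cone_recession x h : (forall t, 0 < t -> K (x + t *: h)) -> K h.
Proof.
move=> Kt.
have Kh t : 0 < t -> K (h + t *: x).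
  move=> t0.
  have : K (t *: (x + t^-1 *: h)).
    by apply: (regular_cone_scale hK (ltW t0)); apply: Kt; rewrite invr_gt0.
  by rewrite scalerDr scalerA divff ?gt_eqF// scale1r addrC.
have c : h + t *: x @[t --> (0 : R)^'+] --> h + 0 *: x.
  apply: cvg_at_right_filter.
  by apply: cvgD; [exact: cvg_cst|apply: cvgZr_tmp; exact: cvg_id].
rewrite scale0r addr0 in c.
apply: (closed_cvg _ (regular_cone_closed hK) _ _ c).
by near=> t; apply: Kh; near: t; exact: nbhs_right_gt.
Unshelve. all: by end_near. Qed.

(** If the form vanished at h, all of x + R h would lie in the Dikin ellipsoid, hence in K, so h and
    -h would be in K. *)
Lemma hessian_posdef x h : interior K x -> h != 0 -> 0 < q x h.
Proof.
move=> Kx; apply: contraNT; rewrite -leNgt => q0.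
have {}q0 : q x h = 0.
  by apply/eqP; rewrite eq_le q0; exact: (hessian_form_ge0 hK hF).
have Kt t : K (x + t *: h).
  apply: interior_subset; apply: (dikin_ellipsoid hK hF) => //.
  by rewrite hessian_scale q0 mulr0.
apply/eqP/(regular_cone_pointed hK).
  by apply: (cone_recession x) => t _; exact: Kt.
apply: (cone_recession x) => t _.
by rewrite scalerN -scaleNr; exact: Kt.
Qed.

Lemma slope_gap x h T : interior K x -> 0 <= T ->
  (forall t, 0 <= t <= T -> interior K (x + t *: h)) ->
  Num.sqrt (q x h) - Num.sqrt (q x h) / (1 + T * Num.sqrt (q x h)) <=
  'D_h F (x + T *: h) - 'D_h F x.
Proof.
move=> Kx T0 KT.
have [->|h0] := eqVneq h 0.
  by rewrite dot0r sqrtr0 mul0r !derive0 !subrr.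
have qp t : 0 <= t <= T -> 0 < q (x + t *: h) h.
  by move=> tT; exact: hessian_posdef (KT _ tT) h0.
set a := Num.sqrt (q x h).
have a0 : 0 < a by rewrite /a sqrtr_gt0; exact: hessian_posdef.
have p1 t : 0 <= t -> 0 < 1 + t * a.
  by move=> t0; rewrite ltr_pwDl// mulr_ge0// ltW.
have lower t : 0 <= t <= T -> (a / (1 + t * a)) ^+ 2 <= q (x + t *: h) h.
  move=> /andP[t0 tT].
  have Ks s : 0 <= s <= t -> interior K (x + s *: h).
    by move=> /andP[s0 st]; apply: KT; rewrite s0 (le_trans st).
  have qs s : 0 <= s <= t -> 0 < q (x + s *: h) h + 0.
    by move=> /andP[s0 st]; rewrite addr0; apply: qp; rewrite s0 (le_trans st).
  have H := self_concordant_line hK hF x h t 0 t0 (lexx _) Ks qs.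
  apply: (rsqrt_lower_bound _ _ _ _ _ _ t0 H); last exact: hessian_posdef.
  by apply: qp; rewrite t0.
(* The term a / (1 + t a) has derivative -(a / (1 + t a))^2, which [lower] compensates: G is
   nondecreasing on [0, T]. *)
pose G := (fun t => 'D_h F (x + t *: h)) + a *: (fun t => (1 + t * a)^-1).
pose dG t := q (x + t *: h) h + a * (- (1 + t * a) ^- 2 * a).
have DG t : 0 <= t <= T -> is_derive t 1 G (dG t).
  move=> tT; have tp : 0 < 1 + t * a by apply: p1; case/andP: tT.
  have D1 := is_derive_slope_line hF x h t (KT _ tT).
  have D2 : is_derive t 1 (cst 1 + (id * cst a) : R -> R) a.
    by apply: is_derive_eq; rewrite /GRing.scale/= mulr0 !add0r mulr1.
  have D3 : is_derive t 1 (fun t => (1 + t * a)^-1) (- (1 + t * a) ^- 2 *: a).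
    by apply: (@is_deriveV R (cst 1 + (id * cst a))) D2; rewrite gt_eqF.
  exact: is_deriveD.
have G0 : G 0 = 'D_h F x + a.
  by rewrite /G !fctE scale0r addr0 mul0r (addr0 1) invr1 /GRing.scale/= mulr1.
have GT : G T = 'D_h F (x + T *: h) + a / (1 + T * a) by [].
have := derive_ge_increment _ _ _ 0 T0 DG.
rewrite mul0r G0 GT opprD addrACA => H.
rewrite -subr_ge0 opprB; apply: H.
move=> t tT; have := lower t tT; rewrite /dG -subr_ge0; congr (_ <= _).
by rewrite expr_div_n mulNr mulrN; congr (_ - _); rewrite expr2; ring.
Qed.

End BarrierInequalities.

(** * Slopes along cone directions and comparison of local norms *)

Section LocalNormComparison.
Context {R : realType} {n : nat} {K : set 'rV[R]_n} {theta : R} {F : 'rV[R]_n -> R}.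
Context (hK : regular_cone K) (hF : LHSCB K theta F).
Implicit Types (x y z h u v w : 'rV[R]_n) (t T e : R).

Local Notation q x h := (dot (h *m hessian F x) h).

Lemma hessian_form_self x : interior K x -> q x x = theta.
Proof.
by move=> Kx; rewrite (hessian_euler hK hF)// (gradient_euler hF)// opprK.
Qed.

Lemma theta_ge0 x : interior K x -> 0 <= theta.
Proof.
by move=> Kx; rewrite -(hessian_form_self x Kx); exact: (hessian_form_ge0 hK hF).
Qed.

Lemma gradient_inequality x y : interior K x -> interior K y ->
  F x + 'D_(y - x) F x <= F y.
Proof.
move=> Kx Ky; set h := y - x.
have Ky' : interior K (x + h) by rewrite subrKC.
have Kt t : 0 <= t <= 1 -> interior K (x + t *: h).
  exact: (interior_cone_segment hK).
have slope t : 0 <= t <= 1 -> 'D_h F x <= 'D_h F (x + t *: h).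
  move=> /andP[t0 t1].
  have := derive_ge_increment (fun s => 'D_h F (x + s *: h))
    (fun s => q (x + s *: h) h) t 0 t0.
  rewrite /= scale0r addr0 mul0r subr_ge0; apply=> s /andP[s0 st].
    by apply: (is_derive_slope_line hF); apply: Kt; rewrite s0 (le_trans st).
  by apply: (hessian_form_ge0 hK hF); apply: Kt; rewrite s0 (le_trans st).
have := derive_ge_increment (fun s => F (x + s *: h))
    (fun s => 'D_h F (x + s *: h)) 1 ('D_h F x) ler01.
rewrite /= scale0r addr0 scale1r mulr1 lerBrDl subrKC; apply => t t01.
  by apply: (is_derive_barrier_line hF); exact: Kt.
exact: slope.
Qed.

(** For z in the interior, F (t z) = F z - theta ln t is bounded above for t >= 1, whereas a
    positive slope would make its tangent lower bound grow linearly in t. A general h in K is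
    approximated by the interior points c x + h. *)
Lemma slope_le0 x h : interior K x -> K h -> 'D_h F x <= 0.
Proof.
move=> Kx Kh; have dF := barrier_differentiable hF x Kx.
have int z : interior K z -> 'D_z F x <= 0.
  move=> Kz; rewrite leNgt; apply/negP => d0.
  pose C := F z - F x - theta.
  pose t := Num.max 1 ((C + 1) / 'D_z F x).
  have t1 : 1 <= t by rewrite le_max lexx.
  have tC : C + 1 <= t * 'D_z F x by rewrite -ler_pdivrMr// le_max lexx orbT.
  have t0 : 0 < t by rewrite (lt_le_trans ltr01).
  have := gradient_inequality x (t *: z) Kx (interior_cone_scale hK z t Kz t0).
  rewrite (derive_linear _ _ t z (- x) dF) -scaleN1r derive_scale//.
  rewrite mulN1r [X in _ - X]derive_gradient// (gradient_euler hF)// opprK.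
  rewrite (LHSCB_log_homogeneous hF Kz t0).
  have lt0 : 0 <= theta * ln t by rewrite mulr_ge0 ?ln_ge0// (theta_ge0 x).
  move: tC lt0; rewrite /C; move: (ln t) (t * _) => l d; lra.
have th0 := theta_ge0 x Kx.
apply/ler_addgt0Pl => e e0; rewrite addr0.
have th1 : 0 < theta + 1 by rewrite ltr_wpDl.
pose c := e / (theta + 1).
have c0 : 0 < c by rewrite divr_gt0.
have := int (c *: x + h) (interior_cone_add hK _ _ (interior_cone_scale hK x c Kx c0) Kh).
rewrite (derive_linear _ _ c x h dF) [X in _ * X + _]derive_gradient//.
rewrite (gradient_euler hF)// mulrN addrC subr_le0 => /le_trans; apply.
by rewrite /c mulrAC ler_pdivrMr// ler_pM2l// lerDl.
Qed.

(* The slope along a recession direction increases to a limit that is at most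
   0, and [slope_gap] bounds its total increase below. *)
Lemma local_norm_le_slope x h : interior K x -> K h ->
  Num.sqrt (q x h) <= - 'D_h F x.
Proof.
move=> Kx Kh; set a := Num.sqrt (q x h).
have gap T : 0 <= T -> a - a / (1 + T * a) <= - 'D_h F x.
  move=> T0; apply: le_trans (slope_gap hK hF x h T Kx T0 _) _.
    by move=> t /andP[t0 _]; exact: (interior_cone_ray hK).
  rewrite gerDr; apply: slope_le0 => //.
  exact: (interior_cone_ray hK).
rewrite leNgt; apply/negP; move: gap; move: (- 'D_h F x) => b gap ba.
have a0 : 0 < a.
  rewrite lt_neqAle sqrtr_ge0 andbT eq_sym; apply/eqP => a0.
  by move: ba (gap 0 (lexx _)); rewrite a0 mul0r subrr; lra.
have ab0 : 0 < a - b by rewrite subr_gt0.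
have iab0 : 0 < (a - b)^-1 by rewrite invr_gt0.
(* At T = 1 / (a - b) the gap reads (a - b) (1 + T a) <= a, that is (a - b) + a <= a, contradicting
   b < a. *)
have := gap _ (ltW iab0).
rewrite lerBlDr -lerBlDl ler_pdivlMr ?addr_gt0 ?mulr_gt0//.
by rewrite mulrDr mulr1 mulrA mulfV ?gt_eqF// mul1r gerDr leNgt ab0.
Qed.

(** Both |x|_x^2 and -<F'(x), x> equal theta, so [local_norm_le_slope] at h = x reads sqrt theta <=
    theta. *)
Lemma theta_ge1 x : (0 < n)%N -> interior K x -> 1 <= theta.
Proof.
move=> n0 Kx.
have th0 : 0 < theta.
  rewrite -(hessian_form_self x Kx); apply: (hessian_posdef hK hF x x Kx).
  exact: (interior_cone_neq0 hK x n0 Kx).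
have := local_norm_le_slope x x Kx (interior_subset Kx).
rewrite hessian_form_self// derive_gradient ?(gradient_euler hF)// ?opprK.
  rewrite -{2}(sqr_sqrtr (ltW th0)) expr2 ler_pMr ?sqrtr_gt0//.
  by rewrite -{1}sqrtr1 ler_psqrt ?nnegrE ?(ltW th0).
exact: (barrier_differentiable hF).
Qed.

Lemma local_norm_comparison x u v : interior K x -> interior K u ->
  Num.sqrt (q x v) <= - 'D_u F x * Num.sqrt (q u v).
Proof.
move=> Kx Ku.
have dF := barrier_differentiable hF x Kx.
have unit_ball h : q u h < 1 -> Num.sqrt (q x h) <= - 'D_u F x.
  move=> h1.
  have Kp : interior K (u + h) by apply: (dikin_ellipsoid hK hF).
  have Km : interior K (u + -1 *: h).
    by apply: (dikin_ellipsoid hK hF) => //; rewrite hessian_scale sqrrN expr1n mul1r.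
  have Np := local_norm_le_slope x _ Kx (interior_subset Kp).
  have Nm := local_norm_le_slope x _ Kx (interior_subset Km).
  have := psd_triangle _ _ _ (u + h) (- 1 *: (u + -1 *: h)) (hessian_psd hK hF x Kx).
  rewrite (hessian_scale x (u + _)) sqrrN expr1n mul1r scalerDr scalerA mulrNN mulr1 scale1r.
  rewrite scaleN1r addrACA subrr add0r -mulr2n -scaler_nat hessian_scale.
  rewrite sqrtrM ?exprn_ge0// sqrtr_sqr ger0_norm// => tri.
  have P : 'D_(u + h) F x = 'D_u F x + 'D_h F x.
    by have := derive_linear F x 1 u h dF; rewrite scale1r mul1r.
  have M : 'D_(u + -1 *: h) F x = 'D_u F x - 'D_h F x.
    by rewrite addrC derive_linear// mulN1r addrC.
  move: Np Nm; rewrite P M; move: (Num.sqrt _) (Num.sqrt _) (Num.sqrt _) tri.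
  move: ('D_u F x) ('D_h F x) => a b c d e; lra.
have A0 : 0 <= - 'D_u F x.
  apply: le_trans (local_norm_le_slope x u Kx (interior_subset Ku)).
  exact: sqrtr_ge0.
set A := - 'D_u F x in unit_ball A0 *.
apply/ler_addgt0Pl => e e0.
have A1 : 0 < A + 1 by rewrite ltr_wpDl.
(* The strict excess puts v / r in the open unit ball even if |v|_u = 0, and costs at most e after
   multiplication by A. *)
pose r := Num.sqrt (q u v) + e / (A + 1).
have rq : Num.sqrt (q u v) < r by rewrite ltrDl divr_gt0.
have r0 : 0 < r by apply: le_lt_trans rq; exact: sqrtr_ge0.
have : Num.sqrt (r^-1 ^+ 2 * q x v) <= A.
  rewrite -hessian_scale; apply: unit_ball; rewrite hessian_scale.
  rewrite exprVn mulrC ltr_pdivrMr ?exprn_gt0// mul1r.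
  have qu0 : 0 <= q u v by exact: (hessian_form_ge0 hK hF).
  rewrite -(sqr_sqrtr qu0); apply: ltrXn2r rq => //; exact: sqrtr_ge0.
rewrite sqrtrM ?exprn_ge0 ?invr_ge0 ?(ltW r0)// sqrtr_sqr.
rewrite ger0_norm ?invr_ge0 ?(ltW r0)// mulrC ler_pdivrMr// => /le_trans; apply.
rewrite /r mulrDr addrC lerD2r mulrA ler_pdivrMr// mulrC ler_pM2l//.
by rewrite lerDl.
Qed.

End LocalNormComparison.

(** * The dual barrier *)

Lemma coord_le_norm (R : realType) n (v : 'rV[R]_n) i : `|v 0 i| <= `|v|.
Proof.
by rewrite [leRHS]/Num.norm/= mx_normrE; exact: (le_bigmax _ _ (0, i)).
Qed.

Lemma norm_le_sum_coord (R : realType) n (v : 'rV[R]_n) : `|v| <= \sum_i `|v 0 i|.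
Proof.
rewrite [leLHS]/Num.norm/= mx_normrE; apply: bigmax_le => [|[i j] _ /=].
  by rewrite sumr_ge0.
by rewrite ord1 (bigD1 j)//= lerDl sumr_ge0.
Qed.

Lemma dot_le_norm (R : realType) n (u v : 'rV[R]_n) :
  `|dot u v| <= (\sum_i `|u 0 i|) * `|v|.
Proof.
rewrite dotE mulr_suml; apply: le_trans (ler_norm_sum _ _ _) _.
by apply: ler_sum => i _; rewrite normrM ler_wpM2l// coord_le_norm.
Qed.

Lemma posdef_unitmx (R : realType) n (A : 'M[R]_n) :
  (forall v : 'rV[R]_n, v != 0 -> 0 < dot (v *m A) v) -> A \in unitmx.
Proof.
move=> pA; rewrite -row_free_unit; apply: inj_row_free => v vA.
apply/eqP; apply: contraT => /pA.
by rewrite vA dot0l ltxx.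
Qed.

Lemma differentiable_expansion (R : realType) n (f : 'rV[R]_n -> R) x e :
  differentiable f x -> 0 < e ->
  \forall h \near (0 : 'rV[R]_n), `|f (x + h) - f x - 'D_h f x| <= e * `|h|.
Proof.
move=> df e0; have /eqaddoP/(_ e e0) := diff_locally df.
apply: filterS => h /=; rewrite !fctE/= opprD addrA => H.
by rewrite [x + h]addrC deriveE.
Qed.

(** From ln (k r) <= k r one gets a ln r <= a k r - a ln k, and k is chosen so that a k <= c / 2:
    half of the linear term survives. *)
Lemma log_linear_bound (R : realType) (a c C : R) : 0 <= a -> 0 < c ->
  exists M, forall r, 0 < r -> c * r <= a * ln r + C -> r <= M.
Proof.
move=> a0 c0; pose k := c / (2 * (a + 1)).
have a1 : 0 < a + 1 by rewrite ltr_wpDl.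
have k0 : 0 < k by rewrite divr_gt0// mulr_gt0.
exists (2 * (C - a * ln k) / c) => r r0 H.
have lnr : ln k + ln r <= k * r.
  rewrite -lnM ?posrE// -{1}[k * r](subrK 1) addrC.
  apply: le_trans (le_ln1Dx _) _; last by rewrite lerBlDr lerDl.
  by rewrite ltrBrDr addNr mulr_gt0.
have ak : a * k * r <= c * r / 2.
  rewrite [leRHS]mulrAC ler_pM2r// /k mulrA ler_pdivrMr ?mulr_gt0//.
  by rewrite mulrA divfK// mulrC ler_pM2l// lerDl.
have := ler_wpM2l a0 lnr; rewrite mulrDr mulrA => H2.
rewrite ler_pdivlMr// mulrC.
move: H H2 ak; move: (c * r) (a * ln r) (a * ln k) (a * k * r) => p1 p2 p3 p4; lra.
Qed.

Section DualBarrier.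
Context {R : realType} {n : nat} {K : set 'rV[R]_n} {theta : R} {F : 'rV[R]_n -> R}.
Context (hK : regular_cone K) (hF : LHSCB K theta F).
Implicit Types (x y z h u v w s : 'rV[R]_n) (t T e : R).

Local Notation q x h := (dot (h *m hessian F x) h).
Local Notation Ks := (interior (dual_cone K)).

(** Homogeneity gives F y = F (y / |y|) - theta ln |y|, and the tangent at x0 bounds F below on unit
    vectors. With <s, y> >= c |y| this leaves c |y| <= theta ln |y| + constant. *)
Lemma sublevel_bounded s x0 : Ks s -> interior K x0 ->
  exists M, forall y, interior K y -> dot s y + F y <= dot s x0 + F x0 -> `|y| <= M.
Proof.
move=> Kss Kx0; have [c c0 cK] := dual_cone_coercive _ Kss.
have th0 := theta_ge0 hK hF x0 Kx0.
pose L := \sum_i `|gradient F x0 0 i|.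
have [M HM] := log_linear_bound R theta c (dot s x0 + L - theta) th0 c0.
exists (Num.max 0 M) => y Ky fy.
have [y0|ry0] := ltP 0 `|y|; last by rewrite le_max ry0.
rewrite le_max; apply/orP; right; apply: HM => //.
have iy0 : 0 < `|y|^-1 by rewrite invr_gt0.
have Kz := interior_cone_scale hK y _ Ky iy0.
have := gradient_inequality hK hF x0 _ Kx0 Kz.
have dF := barrier_differentiable hF x0 Kx0.
rewrite derive_gradient// dotBr (gradient_euler hF)// opprK.
rewrite (LHSCB_log_homogeneous hF Ky iy0) lnV ?posrE// mulrN opprK => FL.
have gL : - L <= dot (gradient F x0) (`|y|^-1 *: y).
  have := dot_le_norm _ _ (gradient F x0) (`|y|^-1 *: y).
  rewrite normrZ normfV normr_id mulVf ?gt_eqF// mulr1 ler_norml.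
  by move=> /andP[].
have := cK _ (interior_subset Ky).
move: FL gL fy; move: (dot (gradient F x0) _) (ln _) (c * _) (dot s y) => a b d e.
by move: (F x0) (F y) (dot s x0) => f g m; rewrite [theta * b]mulrC; move: (b * theta) => b'; lra.
Qed.

End DualBarrier.

Section DualBarrier.
Context {R : realType} {n : nat} {K : set 'rV[R]_n} {theta : R} {F : 'rV[R]_n -> R}.
Context (hK : regular_cone K) (hF : LHSCB K theta F).
Implicit Types (x y z h u v w : 'rV[R]_n) (t T e : R).

Local Notation q x h := (dot (h *m hessian F x) h).
Local Notation Ks := (interior (dual_cone K)).

Lemma dual_minimizer s : Ks s ->
  exists2 u, interior K u &
    forall y, interior K y -> dot s u + F u <= dot s y + F y.
Proof.
move=> Kss; have [x0 Kx0] := regular_cone_interior hK.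
have [M HM] := sublevel_bounded hK hF s x0 Kss Kx0.
pose c0 := dot s x0 + F x0.
(* The sublevel set as a preimage of the epigraph: it is closed in the whole space, so the minimizer
   cannot escape to the boundary of K. *)
pose S := (fun y : 'rV[R]_n => (y, c0 - dot s y)) @^-1`
  [set p : 'rV[R]_n * R | interior K p.1 /\ F p.1 <= p.2].
have SP y : S y <-> interior K y /\ dot s y + F y <= c0.
  by split=> -[Ky /= Fy]; split => //=; move: Fy; rewrite lerBrDl.
have cS : closed S.
  apply: closed_comp; last exact: (LHSCB_closed hF).
  move=> y _; apply: (@cvg_pair _ _ _ (nbhs y) (nbhs y) (nbhs (c0 - dot s y))).
    exact: cvg_id.
  by apply: (@cvgB _ _ _ (nbhs y) _ (cst c0) (dot s)); [exact: cvg_cst|exact: continuous_dot].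
have bS : bounded_set S.
  exists M; split; first exact: num_real.
  move=> m Mm y /SP[Ky Fy]; apply: le_trans (ltW Mm); exact: HM.
have S0 : S x0 by apply/SP.
have cf : {within S, continuous (dot s \+ F)}.
  apply: continuous_in_subspaceT => y /set_mem/SP[Ky _].
  apply: continuousD; first exact: continuous_dot.
  by apply: differentiable_continuous; exact: (barrier_differentiable hF).
have [u /set_mem/SP[Ku Fu] min] := EVT_min_rV (ex_intro _ _ S0)
  (bounded_closed_compact bS cS) cf.
exists u => // y Ky; have [fy|fy] := leP (dot s y + F y) c0.
  by apply: (min y); apply/mem_set/SP.
exact: le_trans Fu (ltW fy).
Qed.

Lemma dual_minimizer_gradient s u : interior K u ->
  (forall y, interior K y -> dot s u + F u <= dot s y + F y) ->
  gradient F u = - s.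
Proof.
move=> Ku min.
suff D0 h : dot s h + 'D_h F u = 0.
  apply/rowP => i; have := D0 (delta_mx 0 i).
  rewrite dot_delta derive_gradient ?dot_delta; last exact: (barrier_differentiable hF).
  by move/eqP; rewrite addrC addr_eq0 => /eqP ->; rewrite !mxE.
have /nbhs_ballP[e /= e0 eK] := @near_line _ _ _ (@open_interior _ K) _ h Ku.
have Kt t : t \in `]- e, e[ -> interior K (u + t *: h).
  rewrite in_itv/= -ltr_norml => te; apply: eK.
  by rewrite /ball/= sub0r normrN.
pose f := (fun t => dot s u + t * dot s h) + (fun t => F (u + t *: h)).
have Df t : t \in `]- e, e[ -> is_derive t 1 f (dot s h + 'D_h F (u + t *: h)).
  move=> /Kt Kth; have D1 := is_derive_barrier_line hF u h t Kth.
  have D2 : is_derive t 1 (cst (dot s u) + (id * cst (dot s h)) : R -> R) (dot s h).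
    by apply: is_derive_eq; rewrite /GRing.scale/= mulr0 !add0r mulr1.
  exact: is_deriveD.
have e0e : 0 \in `]- e, e[ by rewrite in_itv/= oppr_lt0 e0.
have D0 : is_derive (0 : R) 1 f 0.
  apply: (@derive1_at_min _ f (- e) e 0) => //.
  - by rewrite ge0_cp ?(ltW e0).
  - by move=> t te; have D := Df _ te; exact: ex_derive.
  - move=> t te; rewrite /f !fctE mul0r scale0r !addr0 -dotZr -dotDr.
    by apply: min; exact: Kt.
have := @derive_val _ _ _ _ _ _ _ (Df _ e0e).
by rewrite (@derive_val _ _ _ _ _ _ _ D0) scale0r addr0.
Qed.

End DualBarrier.

(** The point u of the overview, chosen as a minimizer because F_*' is not yet known to exist; 0 if
    there is no minimizer. *)
Definition dual_argmax (R : realType) (n : nat) (K : set 'rV[R]_n)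
    (F : 'rV[R]_n -> R) (s : 'rV[R]_n) : 'rV[R]_n :=
  xget 0 [set u | interior K u /\
    forall y, interior K y -> dot s u + F u <= dot s y + F y].

(** * First and second derivatives of the dual barrier *)

Section DualDerivatives.
Context {R : realType} {n : nat} {K : set 'rV[R]_n} {theta : R} {F : 'rV[R]_n -> R}.
Context (hK : regular_cone K) (hF : LHSCB K theta F).
Implicit Types (x y z h u v w : 'rV[R]_n) (t T e : R).

Local Notation q x h := (dot (h *m hessian F x) h).
Local Notation Ks := (interior (dual_cone K)).
Local Notation argmax := (dual_argmax R n K F).
Local Notation Fs := (dual_barrier K F).

Lemma dual_argmaxP s : Ks s -> interior K (argmax s) /\
  forall y, interior K y -> dot s (argmax s) + F (argmax s) <= dot s y + F y.
Proof.
move=> Kss; have [u Ku min] := dual_minimizer hK hF s Kss.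
by apply: (@xgetPex _ 0 [set u | interior K u /\
    forall y, interior K y -> dot s u + F u <= dot s y + F y]); exists u.
Qed.

Lemma gradient_argmax s : Ks s -> gradient F (argmax s) = - s.
Proof.
by move=> /dual_argmaxP[Ku min]; exact: (dual_minimizer_gradient hF _ _ Ku min).
Qed.

Lemma dual_barrierE s : Ks s -> Fs s = - dot s (argmax s) - F (argmax s).
Proof.
move=> /dual_argmaxP[Ku min]; apply/eqP; rewrite eq_le; apply/andP; split.
  apply: ge_sup; first by exists (- dot s (argmax s) - F (argmax s)); exists (argmax s).
  by move=> _ [y Ky <-]; rewrite -!opprD lerN2; exact: min.
apply: ub_le_sup; last by exists (argmax s).
exists (- dot s (argmax s) - F (argmax s)).
by move=> _ [y Ky <-]; rewrite -!opprD lerN2; exact: min.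
Qed.

Lemma dual_barrier_ge s y : Ks s -> interior K y -> - dot s y - F y <= Fs s.
Proof.
move=> Kss Ky; rewrite dual_barrierE// -!opprD lerN2.
exact: (dual_argmaxP s Kss).2.
Qed.

(** Cauchy-Schwarz for the Hessian form, after writing w as (w H^-1) H with H = F''(x). It turns
    local-norm estimates into estimates of coordinates. *)
Lemma dot_le_local_norm x : interior K x -> forall w,
  exists2 c, 0 <= c & forall h, `|dot w h| <= c * Num.sqrt (q x h).
Proof.
move=> Kx w.
have Hu : hessian F x \in unitmx.
  by apply: posdef_unitmx => v; exact: (hessian_posdef hK hF).
exists (Num.sqrt (q x (w *m invmx (hessian F x)))) => [|h]; first exact: sqrtr_ge0.
have := psd_cauchy_schwarz _ _ _ (w *m invmx (hessian F x)) h (hessian_psd hK hF x Kx).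
rewrite mulmxKV// => CS.
rewrite -sqrtrM; last first.
  have := (hessian_form_ge0 hK hF x (w *m invmx (hessian F x)) Kx).
  by rewrite mulmxKV.
by rewrite -sqrtr_sqr ler_wsqrtr.
Qed.

(* Strong monotonicity of the gradient ([slope_gap]) makes its inverse
   Lipschitz along lines in the local norm. *)
Lemma argmax_local_lipschitz s v : Ks s ->
  exists2 C, 0 <= C & \forall t \near (0 : R), Ks (s + t *: v) /\
    Num.sqrt (q (argmax s) (argmax (s + t *: v) - argmax s)) <= C * `|t|.
Proof.
move=> Kss; have [Ku _] := dual_argmaxP s Kss.
have [c c0 cP] := dot_le_local_norm _ Ku v.
exists (2 * c); first by rewrite mulr_ge0.
have c1 : 0 < 2 * (c + 1) by rewrite mulr_gt0// ltr_wpDl.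
near=> t.
have Kst : Ks (s + t *: v) by near: t; exact: (near_line (@open_interior _ _)).
have tc : `|t| < (2 * (c + 1))^-1.
  by near: t; apply: (@nbhs0_lt _ R^o); rewrite invr_gt0.
split => //.
have [Kut _] := dual_argmaxP _ Kst.
set h := argmax (s + t *: v) - argmax s.
have Kh : interior K (argmax s + h) by rewrite subrKC.
have gap := slope_gap hK hF (argmax s) h 1 Ku ler01
  (fun r => interior_cone_segment hK _ _ _ Ku Kh).
move: gap; rewrite scale1r mul1r.
rewrite !derive_gradient; [|exact: (barrier_differentiable hF)..].
rewrite subrKC !gradient_argmax// !dotNl dotDl dotZl opprD addrAC subrr add0r.
have := cP h; move: (sqrtr_ge0 (q (argmax s) h)).
move: (Num.sqrt _) (dot v h) => r d r0 dr gap.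
have td : - (t * d) <= `|t| * (c * r).
  by rewrite -mulNr; apply: le_trans (ler_norm _) _; rewrite normrM normrN ler_wpM2l.
have r1 : 0 < 1 + r by rewrite ltr_pwDl.
(* The gap r - r / (1 + r) is r^2 / (1 + r). Dividing by r gives r <= |t| c (1 + r), and |t| c <=
   1/2 absorbs the r on the right. *)
have {}gap : r * r <= `|t| * (c * r) * (1 + r).
  rewrite -ler_pdivrMr//; apply: le_trans td; apply: le_trans gap.
  by rewrite le_eqVlt; apply/orP; left; apply/eqP; field; exact: lt0r_neq0.
have [->|rn0] := eqVneq r 0; first by rewrite !mulr_ge0.
have rp : 0 < r by rewrite lt_neqAle eq_sym rn0.
have : r <= `|t| * c * (1 + r).
  rewrite -(ler_pM2r rp); apply: le_trans gap _.
  by rewrite le_eqVlt; apply/orP; left; apply/eqP; ring.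
rewrite mulrDr mulr1 => gap2.
have tc2 : `|t| * c <= 2^-1.
  move: tc; rewrite -[X in _ < X]mul1r ltr_pdivlMr// => tc.
  by have := normr_ge0 t; move: tc; move: `|t| => t' tc t'0; nra.
have -> : 2 * c * `|t| = 2 * (`|t| * c) by ring.
have := ler_wpM2r r0 tc2; move: gap2 {tc2}; move: (`|t| * c * r) (`|t| * c) => p a; lra.
Unshelve. all: by end_near. Qed.

End DualDerivatives.

Lemma is_derive_bound (R : realType) n (f : 'rV[R]_n -> R) (s v : 'rV[R]_n) (l : R) :
  (forall e, 0 < e -> \forall t \near (0 : R),
    `|f (s + t *: v) - f s - t * l| <= e * `|t|) -> is_derive s v f l.
Proof.
move=> H.
have c : t^-1 *: ((f \o shift s) (t *: v) - f s) @[t --> (0 : R)^'] --> l.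
  apply/cvgrPdist_le => e e0; near=> t.
  have t0 : t != 0 by near: t; exact: nbhs_dnbhs_neq.
  have Ht : `|f (s + t *: v) - f s - t * l| <= e * `|t|.
    near: t; exact: (nbhs_dnbhs (H e e0)).
  rewrite distrC /GRing.scale/= [_ + s]addrC.
  rewrite -(ler_pM2r (_ : 0 < `|t|)) ?normr_gt0// -normrM mulrBl mulrAC mulVf// mul1r.
  by rewrite [l * t]mulrC.
by split; [exact: cvgP c|exact: cvg_lim c].
Unshelve. all: by end_near. Qed.

Section DualDerivatives.
Context {R : realType} {n : nat} {K : set 'rV[R]_n} {theta : R} {F : 'rV[R]_n -> R}.
Context (hK : regular_cone K) (hF : LHSCB K theta F).
Implicit Types (x y z h u v w : 'rV[R]_n) (t T e : R).

Local Notation q x h := (dot (h *m hessian F x) h).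
Local Notation Ks := (interior (dual_cone K)).
Local Notation argmax := (dual_argmax R n K F).
Local Notation Fs := (dual_barrier K F).

Lemma argmax_lipschitz s v : Ks s ->
  exists2 C, 0 <= C & \forall t \near (0 : R), Ks (s + t *: v) /\
    `|argmax (s + t *: v) - argmax s| <= C * `|t|.
Proof.
move=> Kss; have [Ku _] := dual_argmaxP hK hF s Kss.
have [C C0 HC] := argmax_local_lipschitz hK hF s v Kss.
have /choice[c cP] : forall i, exists c, 0 <= c /\
    forall h, `|h 0 i| <= c * Num.sqrt (q (argmax s) h).
  move=> i; have [c c0 cP] := dot_le_local_norm hK hF _ Ku (delta_mx 0 i).
  by exists c; split => // h; rewrite -dot_delta dotC.
exists (\sum_i c i * C); first by rewrite sumr_ge0// => i _; rewrite mulr_ge0// (cP i).1.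
apply: filterS HC => t [Kt Ht]; split => //.
apply: le_trans (norm_le_sum_coord _ _ _) _; rewrite mulr_suml.
apply: ler_sum => i _; apply: le_trans ((cP i).2 _) _.
by rewrite -mulrA ler_wpM2l// (cP i).1.
Qed.

(** Envelope argument: testing each of the two suprema with the maximizer of the other confines the
    first-order error to |t <v, u_t - u>|, where u_t is the maximizer at s + t v. This is O(t^2) by
    the Lipschitz estimate. *)
Lemma is_derive_dual_barrier s v : Ks s ->
  is_derive s v Fs (- dot v (argmax s)).
Proof.
move=> Kss; apply: is_derive_bound => e e0.
have [C C0 HC] := argmax_lipschitz s v Kss.
pose L := \sum_i `|v 0 i|.
have L0 : 0 <= L by rewrite sumr_ge0.
have LC : 0 < L * C + 1 by rewrite ltr_wpDl// mulr_ge0.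
near=> t.
have te : `|t| < e / (L * C + 1).
  by near: t; apply: (@nbhs0_lt _ R^o); rewrite divr_gt0.
have [Kt Ht] : Ks (s + t *: v) /\ `|argmax (s + t *: v) - argmax s| <= C * `|t|.
  by near: t.
have [Ku _] := dual_argmaxP hK hF s Kss.
have [Kut _] := dual_argmaxP hK hF _ Kt.
have lo := dual_barrier_ge hK hF _ _ Kt Ku.
have hi := dual_barrier_ge hK hF _ _ Kss Kut.
have vh := dot_le_norm _ _ v (argmax (s + t *: v) - argmax s).
have {}vh : `|dot v (argmax (s + t *: v) - argmax s)| <= e.
  apply: le_trans vh _; rewrite -/L.
  apply: le_trans (ler_wpM2l L0 Ht) _; rewrite mulrA.
  apply: le_trans (ler_wpM2l (mulr_ge0 L0 C0) (ltW te)) _.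
  by rewrite mulrCA ler_piMr ?(ltW e0)// ler_pdivrMr// mul1r lerDl.
have : `|Fs (s + t *: v) - Fs s - t * - dot v (argmax s)| <=
    `|t * dot v (argmax (s + t *: v) - argmax s)|.
  move: lo hi; rewrite (dual_barrierE hK hF s)// (dual_barrierE hK hF _ Kt).
  rewrite !dotDl !dotZl dotBr mulrN opprK.
  move: (dot s (argmax (s + t *: v))) (F (argmax (s + t *: v))) => a1 a2.
  move: (dot v (argmax (s + t *: v))) => a3.
  move: (dot s _) (F _) (dot v _) => a4 a5 a6 lo hi.
  rewrite -[leRHS]normrN [leRHS]ger0_norm ?ler_norml; last by lra.
  by apply/andP; split; lra.
move=> /le_trans; apply.
by rewrite normrM mulrC ler_wpM2r.
Unshelve. all: by end_near. Qed.

Lemma gradient_dual_barrier s : Ks s -> gradient Fs s = - argmax s.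
Proof.
move=> Kss; apply/rowP => i; rewrite !mxE.
have D := is_derive_dual_barrier s (delta_mx 0 i) Kss.
by rewrite (@derive_val _ _ _ _ _ _ _ D) dotC dot_delta.
Qed.

(** With h = u_t - u and H = F''(u), expanding F'(u_t) = -(s + t v) at u gives t v + h H = o(|h|),
    which is o(t) by the Lipschitz estimate; multiply by H^-1 on the right. *)
Lemma is_derive_argmax s v j : Ks s ->
  is_derive s v (fun s' => argmax s' 0 j)
    (- (v *m invmx (hessian F (argmax s))) 0 j).
Proof.
move=> Kss; apply: is_derive_bound => e e0.
have [C C0 HC] := argmax_lipschitz s v Kss.
have [Ku _] := dual_argmaxP hK hF s Kss.
set u := argmax s in Ku HC *; set H := hessian F u.
have HU : H \in unitmx.
  by apply: posdef_unitmx => w; exact: (hessian_posdef hK hF).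
pose M := \sum_k `|invmx H k j|.
have M0 : 0 <= M by rewrite sumr_ge0.
have CM : 0 < C * M + 1 by rewrite ltr_wpDl// mulr_ge0.
pose e' := e / (C * M + 1).
have e'0 : 0 < e' by rewrite divr_gt0.
have : \forall h \near (0 : 'rV[R]_n), forall k : 'I_n,
    `|'D_(delta_mx 0 k) F (u + h) - 'D_(delta_mx 0 k) F u
      - 'D_h ('D_(delta_mx 0 k) F) u| <= e' * `|h|.
  have Pk k := differentiable_expansion _ _ _ u e'
    (barrier_differentiable2 hF (delta_mx 0 k) u Ku) e'0.
  exact: (filter_forall _ Pk).
move=> /nbhs_ballP[d /= d0 dP].
near=> t.
have [Kt Ht] : Ks (s + t *: v) /\ `|argmax (s + t *: v) - u| <= C * `|t|.
  by near: t.
have td : `|t| < d / (C + 1).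
  by near: t; apply: (@nbhs0_lt _ R^o); rewrite divr_gt0// ltr_wpDl.
pose h := argmax (s + t *: v) - u.
have hd : `|h| < d.
  apply: le_lt_trans Ht _.
  rewrite ltr_pdivlMr ?ltr_wpDl// in td.
  by apply: le_lt_trans td; rewrite mulrC ler_wpM2l// lerDl.
have hP k : `|(t *: v + h *m H) 0 k| <= e' * (C * `|t|).
  have bh : ball 0 d h by rewrite -ball_normE/= sub0r normrN.
  have := dP h bh k.
  rewrite -(hessian_form hF)// dot_delta.
  have gE x : interior K x -> 'D_(delta_mx 0 k) F x = gradient F x 0 k.
    by rewrite mxE.
  rewrite !gE//; last by rewrite subrKC; exact: (dual_argmaxP hK hF _ Kt).1.
  rewrite subrKC !(gradient_argmax hK hF)// -/u -/H => Hk.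
  apply: le_trans (ler_wpM2l (ltW e'0) Ht); apply: le_trans Hk.
  rewrite -[leLHS]normrN le_eqVlt; apply/orP; left; apply/eqP; congr `|_|.
  by rewrite !mxE; ring.
have -> : argmax (s + t *: v) 0 j - u 0 j - t * - (v *m invmx H) 0 j =
    \sum_k (t *: v + h *m H) 0 k * invmx H k j.
  have <- : ((t *: v + h *m H) *m invmx H) 0 j = \sum_k (t *: v + h *m H) 0 k * invmx H k j.
    by rewrite mxE.
  by rewrite mulmxDl mulmxK// -scalemxAl !mxE; ring.
apply: le_trans (ler_norm_sum _ _ _) _.
apply: (@le_trans _ _ (\sum_k (e' * (C * `|t|)) * `|invmx H k j|)).
  by apply: ler_sum => k _; rewrite normrM ler_wpM2r.
rewrite -mulr_sumr -/M -!mulrA [`|t| * M]mulrC !mulrA ler_wpM2r//.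
by rewrite /e' -!mulrA ler_piMr ?(ltW e0)// mulrC ler_pdivrMr// mul1r lerDl.
Unshelve. all: by end_near. Qed.

Lemma hessian_dual_barrier s : Ks s ->
  hessian Fs s = invmx (hessian F (argmax s)).
Proof.
move=> Kss; apply/matrixP => i j; rewrite mxE.
have E : \near s, - (argmax s 0 j) = 'D_(delta_mx 0 j) Fs s.
  apply: filterS (open_nbhs_nbhs (conj (@open_interior _ _) Kss)) => s' Ks'.
  have D := is_derive_dual_barrier s' (delta_mx 0 j) Ks'.
  by rewrite (@derive_val _ _ _ _ _ _ _ D) dotC dot_delta.
rewrite -(near_eq_derive _ E).
have D := is_deriveN (is_derive_argmax s (delta_mx 0 i) j Kss).
by rewrite (@derive_val _ _ _ _ _ _ _ D) opprK -rowE mxE.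
Qed.

End DualDerivatives.

(** * The primal-dual pair *)

Lemma sqrt_le_square (R : realType) (a b c : R) : 0 <= a -> 0 <= b ->
  Num.sqrt a <= c * Num.sqrt b -> a <= c ^+ 2 * b.
Proof.
move=> a0 b0 H; rewrite -(sqr_sqrtr a0) -(sqr_sqrtr b0) -exprMn.
by rewrite ler_pXn2r ?nnegrE ?sqrtr_ge0// (le_trans _ H)// sqrtr_ge0.
Qed.

Section PrimalDualPair.
Context {R : realType} {n : nat} {K : set 'rV[R]_n} {theta : R} {F : 'rV[R]_n -> R}.
Context (hK : regular_cone K) (hF : LHSCB K theta F).
Context {x s : 'rV[R]_n} (Kx : interior K x) (Kss : interior (dual_cone K) s).
Implicit Types (v : 'rV[R]_n).

Local Notation q x h := (dot (h *m hessian F x) h).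
Local Notation u := (dual_argmax R n K F s).
Local Notation mut := (mu_tilde K theta F x s).

Let Ku : interior K u := proj1 (dual_argmaxP hK hF s Kss).

Lemma hessian_form_comparison v :
  q x v <= (dot (gradient F x) (gradient (dual_barrier K F) s)) ^+ 2 * q u v.
Proof.
have -> : dot (gradient F x) (gradient (dual_barrier K F) s) = - 'D_u F x.
  rewrite (gradient_dual_barrier hK hF)// dotNr derive_gradient//.
  exact: (barrier_differentiable hF).
have N := local_norm_comparison hK hF x u v Kx Ku.
exact: (sqrt_le_square _ _ _ _ (hessian_form_ge0 hK hF x v Kx)
  (hessian_form_ge0 hK hF u v Ku) N).
Qed.

Lemma lambda_max_le :
  Num.sqrt (lambda_max (hessian F x *m hessian (dual_barrier K F) s)) <=
  `|dot (gradient F x) (gradient (dual_barrier K F) s)|.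
Proof.
set A := dot _ _; rewrite -sqrtr_sqr ler_wsqrtr// /lambda_max.
set E := [set a | _].
(* On an empty spectrum [sup] takes the value 0. *)
have [->|/set0P[a Ea]] := eqVneq E set0; first by rewrite sup0 sqr_ge0.
apply: ge_sup; first by exists a.
move=> {a Ea} a /eigenvalueP[v]; rewrite (hessian_dual_barrier hK hF)// => va v0.
have qu : 0 < q u v := hessian_posdef hK hF u v Ku v0.
have Hu : hessian F u \in unitmx.
  by apply: posdef_unitmx => w; exact: (hessian_posdef hK hF).
(* The eigenvector equation v F''(x) F''(u)^-1 = a v, multiplied by F''(u), is v F''(x) = a v
   F''(u). *)
have E1 : q x v = a * q u v.
  by rewrite -dotZl scalemxAl -va -mulmxA mulmxKV.
by rewrite -(ler_pM2r qu) -E1; exact: hessian_form_comparison.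
Qed.

Context (n0 : (0 < n)%N).

Lemma mu_gt0 : 0 < mu theta x s.
Proof.
have th0 : 0 < theta := lt_le_trans ltr01 (theta_ge1 hK hF x n0 Kx).
rewrite /mu divr_gt0//.
have [c c0 /(_ _ (interior_subset Kx))] := dual_cone_coercive s Kss.
by apply: lt_le_trans; rewrite mulr_gt0// normr_gt0 (interior_cone_neq0 hK x n0 Kx).
Qed.

Lemma dot_gradients_gt0 : 0 < dot (gradient F x) (gradient (dual_barrier K F) s).
Proof.
rewrite (gradient_dual_barrier hK hF)// dotNr -derive_gradient; last first.
  exact: (barrier_differentiable hF).
apply: lt_le_trans (local_norm_le_slope hK hF x u Kx (interior_subset Ku)).
rewrite sqrtr_gt0; apply: (hessian_posdef hK hF x u Kx).
exact: (interior_cone_neq0 hK u n0 Ku).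
Qed.

Lemma mu_tilde_gt0 : 0 < mut.
Proof.
have th0 : 0 < theta := lt_le_trans ltr01 (theta_ge1 hK hF x n0 Kx).
by rewrite /mu_tilde divr_gt0// dot_gradients_gt0.
Qed.

End PrimalDualPair.

(** * The inequality mu mu~ >= 1 *)

Section BarrierGap.
Context {R : realType} {n : nat} {K : set 'rV[R]_n} {theta : R} {F : 'rV[R]_n -> R}.
Context (hK : regular_cone K) (hF : LHSCB K theta F).

(* The gradient inequality at [y], applied to the multiple of [z] on the
   supporting hyperplane of the level set of [F] through [y]. *)
Lemma barrier_log_gap (y z : 'rV[R]_n) : interior K y -> interior K z ->
  0 < theta -> 0 < - dot (gradient F y) z ->
  F y <= F z - theta * ln (theta / - dot (gradient F y) z).
Proof.
move=> Ky Kz th0 b0; set b := - dot (gradient F y) z in b0 *.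
have t0 : 0 < theta / b by rewrite divr_gt0.
have dF := barrier_differentiable hF y Ky.
have := gradient_inequality hK hF y _ Ky (interior_cone_scale hK z _ Kz t0).
rewrite (LHSCB_log_homogeneous hF Kz t0); apply: le_trans.
rewrite derive_gradient// dotBr dotZr (gradient_euler hF)// opprK lerDl.
have -> : dot (gradient F y) z = - b by rewrite opprK.
by rewrite mulrN divfK ?gt_eqF// addNr.
Qed.

(** Adding [barrier_log_gap] for (x, u) and for (u, x) cancels the values of F and leaves ln
    (theta^2 / (a b)) <= 0, with a = theta mu~ and b = theta mu. *)
Lemma mu_mu_tilde_ge1 (x s : 'rV[R]_n) : (0 < n)%N -> interior K x ->
  interior (dual_cone K) s -> 1 <= mu theta x s * mu_tilde K theta F x s.
Proof.
move=> n0 Kx Kss; have [Ku _] := dual_argmaxP hK hF s Kss.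
have th0 : 0 < theta := lt_le_trans ltr01 (theta_ge1 hK hF x n0 Kx).
have A0 := dot_gradients_gt0 hK hF Kx Kss n0.
have B0 : 0 < dot s x.
  by have := mu_gt0 hK hF Kx Kss n0; rewrite /mu pmulr_lgt0// invr_gt0.
rewrite /mu /mu_tilde; move: A0.
rewrite (gradient_dual_barrier hK hF)// dotNr => A0.
have := barrier_log_gap _ _ Kx Ku th0 A0.
have := barrier_log_gap _ _ Ku Kx th0.
rewrite (gradient_argmax hK hF)// dotNl opprK => /(_ B0).
set a := - dot _ _ in A0 *; set b := dot s x in B0 *.
move=> h1 h2.
have ln0 : ln (theta / b) + ln (theta / a) <= 0.
  by rewrite -(pmulr_rle0 _ th0) mulrDr; lra.
rewrite -lnM ?posrE ?divr_gt0// in ln0.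
rewrite -ln1 ler_ln ?posrE ?mulr_gt0 ?invr_gt0// in ln0.
have p : 0 < theta / b * (theta / a) by rewrite mulr_gt0 ?divr_gt0.
rewrite -(ler_pM2l p) mulr1 (_ : _ * (b / theta * (a / theta)) = 1)//.
by field; rewrite !gt_eqF.
Qed.

End BarrierGap.

(** * Dimension zero *)

Lemma dim0_zero (R : realType) (v : 'rV[R]_0) : v = 0.
Proof. by apply/rowP => -[]. Qed.

Lemma dim0_dot (R : realType) (v w : 'rV[R]_0) : dot v w = 0.
Proof. by rewrite (dim0_zero _ v) dot0l. Qed.

Lemma dim0_psd (R : realType) (A : 'M[R]_0) : psd A.
Proof. by split=> [|v]; [apply/matrixP => -[]|rewrite dim0_dot]. Qed.

(** The only point is fixed by scaling, so homogeneity with t = 2 forces theta ln 2 = 0. *)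
Lemma dim0_theta (R : realType) (K : set 'rV[R]_0) (theta : R) (F : 'rV[R]_0 -> R) :
  regular_cone K -> LHSCB K theta F -> theta = 0.
Proof.
move=> hK hF; have [x Kx] := regular_cone_interior hK.
have := LHSCB_log_homogeneous hF Kx (ltr0Sn R 1).
rewrite (dim0_zero _ x) scaler0 => /eqP; rewrite eq_sym subr_eq addrC -subr_eq subrr.
rewrite eq_sym mulf_eq0 => /orP[/eqP//|].
by rewrite gt_eqF// ln_gt0// ltr1n.
Qed.

Lemma dim0_lambda_max (R : realType) (A : 'M[R]_0) : lambda_max A = 0.
Proof.
rewrite /lambda_max (_ : mkset _ = set0) ?sup0//.
apply/seteqP; split=> // a /eigenvalueP[v _].
by rewrite (dim0_zero _ v) eqxx.
Qed.

Lemma psd_lincomb (R : realType) n (A B : 'M[R]_n) (a b : R) :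
  A^T = A -> B^T = B ->
  (forall v : 'rV[R]_n, b * dot (v *m B) v <= a * dot (v *m A) v) ->
  psd (a *: A - b *: B).
Proof.
move=> sA sB H; split=> [|v]; first by rewrite linearB/= !linearZ/= sA sB.
by rewrite mulmxBr dotBl -!scalemxAr !dotZl subr_ge0.
Qed.

(** * The ratio bound and a feasible scaling matrix *)

Section Ratio.
Context {R : realType} {n : nat} {K : set 'rV[R]_n} {theta : R} {F : 'rV[R]_n -> R}.
Context (hK : regular_cone K) (hF : LHSCB K theta F) (n0 : (0 < n)%N).
Context {x s : 'rV[R]_n} (Kx : interior K x) (Kss : interior (dual_cone K) s).

Local Notation m := (mu theta x s * mu_tilde K theta F x s).
Local Notation ratio :=
  (Num.sqrt (lambda_max (hessian F x *m hessian (dual_barrier K F) s))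
            / deltaF K theta F x s).

Let th1 : 1 <= theta := theta_ge1 hK hF x n0 Kx.
Let m1 : 1 <= m := mu_mu_tilde_ge1 hK hF x s n0 Kx Kss.

Lemma gap_gt0 : 0 < theta * (m - 1) + 1.
Proof. by rewrite ltr_wpDl// mulr_ge0 ?subr_ge0// (le_trans ler01). Qed.

Lemma dot_gradients : dot (gradient F x) (gradient (dual_barrier K F) s) =
  theta * mu_tilde K theta F x s.
Proof. by rewrite /mu_tilde mulrC divfK// gt_eqF// (lt_le_trans ltr01). Qed.

Lemma deltaF_gt0 : 0 < deltaF K theta F x s.
Proof. by rewrite /deltaF divr_gt0 ?(mu_gt0 hK hF Kx Kss n0) ?gap_gt0. Qed.

Lemma ratio_le : ratio <= theta * m / (theta * (m - 1) + 1).
Proof.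
have mu0 := mu_gt0 hK hF Kx Kss n0.
have mt0 := mu_tilde_gt0 hK hF Kx Kss n0.
rewrite ler_pdivrMr ?deltaF_gt0//.
apply: le_trans (lambda_max_le hK hF Kx Kss) _.
rewrite dot_gradients ger0_norm; last first.
  by rewrite mulr_ge0 ?(ltW mt0)// (le_trans ler01).
have E (D a b : R) : 0 < D -> 0 < a -> theta * (a * b) / D * (D / a) = theta * b.
  by move=> D0 a0; field; rewrite !gt_eqF.
by rewrite /deltaF /gammaG E ?gap_gt0.
Qed.

(** Since F_*''(s)^-1 = F''(u), taking T = k F''(u) turns the upper constraint into an equality. The
    lower one asks for F''(x) <= k^2 F''(u), which follows from theta mu~ <= k. *)
Lemma T_check_nonempty : T_check K theta F x s (2 * theta) !=set0.
Proof.
have mu0 := mu_gt0 hK hF Kx Kss n0.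
have mt0 := mu_tilde_gt0 hK hF Kx Kss n0.
have d0 := deltaF_gt0.
have th0 : 0 < theta := lt_le_trans ltr01 th1.
have [Ku _] := dual_argmaxP hK hF s Kss.
set k := 2 * theta * deltaF K theta F x s.
have k0 : 0 < k := mulr_gt0 (mulr_gt0 (ltr0Sn _ _) th0) d0.
have Hu := hessian_psd hK hF _ Ku.
have Hs := hessian_dual_barrier hK hF s Kss.
(* After multiplication by mu / theta this is m <= 2 (theta (m - 1) + 1) with m = mu mu~, true as m
   and theta are at least 1. *)
have kA : theta * mu_tilde K theta F x s <= k.
  have := gap_gt0; rewrite /k /deltaF /gammaG.
  move: m1 mu0 mt0; move: (mu theta x s) (mu_tilde K theta F x s) => a b ab1 a0 b0 g0.
  rewrite [leRHS]mulrA ler_pdivlMr//.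
  have -> : theta * b * a = theta * (a * b) by ring.
  have -> c : 2 * theta * c = theta * (2 * c) by ring.
  rewrite ler_pM2l//; move: ab1 th1; move: (a * b) => p p1 t1; nra.
exists (k *: hessian F (dual_argmax R n K F s)); split.
- split; first by rewrite linearZ/= Hu.1.
  move=> v v0; rewrite -scalemxAr dotZl mulr_gt0//.
  exact: (hessian_posdef hK hF _ _ Ku v0).
- apply: psd_lincomb => [||v]; [exact: Hu.1|exact: (hessian_psd hK hF x Kx).1|].
  rewrite -/k mul1r ler_pdivrMl// mulrA -expr2.
  apply: le_trans (hessian_form_comparison hK hF Kx Kss v) _.
  rewrite dot_gradients ler_wpM2r//; first exact: Hu.2.
  by rewrite ler_pXn2r// nnegrE ?(ltW k0)// mulr_ge0// ltW.
rewrite /loewner_le Hs invmxK subrr; split; first by rewrite linear0.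
by move=> v; rewrite mulmx0 dot0l.
Qed.

End Ratio.

Theorem theorem5p4 (R : realType) (n : nat) (K : set 'rV[R]_n) (theta : R)
    (F : 'rV[R]_n -> R)
    (hK : regular_cone K) (hF : LHSCB K theta F) :
  [/\ forall x s : 'rV[R]_n, interior K x -> interior (dual_cone K) s ->
        Num.sqrt (lambda_max (hessian F x *m hessian (dual_barrier K F) s))
            / deltaF K theta F x s
          <= 2 + 2 * (theta - 1) /
                 (theta * (mu theta x s * mu_tilde K theta F x s - 1) + 1)
        /\
        2 + 2 * (theta - 1) /
            (theta * (mu theta x s * mu_tilde K theta F x s - 1) + 1)
          = 2 + 2 * (theta - 1) / (gammaG K theta F x s + 1),
      (xi_check K theta F <= (2 * theta)%:E)%E
    & forall x s : 'rV[R]_n, interior K x -> interior (dual_cone K) s ->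
        2 <= mu theta x s * mu_tilde K theta F x s ->
        Num.sqrt (lambda_max (hessian F x *m hessian (dual_barrier K F) s))
            / deltaF K theta F x s <= 4].
Proof.
case: n => [|n] in K F hK hF *.
  have th0 := dim0_theta _ _ _ _ hK hF; subst theta; split.
  - move=> x s _ _; split => //.
    (* Both sides are 0: the right one is 2 + 2 (0 - 1) / 1. *)
    by rewrite dim0_lambda_max sqrtr0 !mul0r !add0r invr1; lra.
  (* Every e > 0 is feasible, because each matrix of size 0 is positive semidefinite; hence the
     infimum is at most 0 = 2 theta. *)
  - apply/lee_addgt0Pr => e e0; rewrite mulr0 add0e; apply: ereal_inf_lbound.
    exists e => //; split=> // x s _ _; exists 0.
    split; try exact: dim0_psd; split=> [|v]; first by rewrite trmx0.
    by rewrite (dim0_zero _ v) eqxx.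
  - move=> x s _ _; rewrite /mu dim0_dot !mul0r => H.
    by exfalso; move: H; rewrite leNgt ltr0Sn.
have [x0 Kx0] := regular_cone_interior hK.
have th1 := theta_ge1 hK hF x0 isT Kx0.
split.
- move=> x s Kx Kss; split=> //.
  apply: le_trans (ratio_le hK hF isT Kx Kss) _.
  have := gap_gt0 hK hF isT Kx Kss; move: (_ * mu_tilde K theta F x s) => m D0.
  (* With D = theta (m - 1) + 1 the right side is (2 D + 2 (theta - 1)) / D = 2 theta m / D. *)
  rewrite -[X in _ <= X + _](mulfK (lt0r_neq0 D0)) -mulrDl ler_pM2r ?invr_gt0//.
  have := D0; lra.
- apply: ereal_inf_lbound; exists (2 * theta) => //.
  split; first by rewrite mulr_gt0// (lt_le_trans ltr01).
  by move=> x s; exact: (T_check_nonempty hK hF isT).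
- move=> x s Kx Kss m2; apply: le_trans (ratio_le hK hF isT Kx Kss) _.
  have := gap_gt0 hK hF isT Kx Kss; move: m2.
  move: (_ * mu_tilde K theta F x s) => m m2 D0.
  (* The claim theta m <= 4 (theta (m - 1) + 1) amounts to theta (3 m - 4) + 4 >= 0. *)
  rewrite ler_pdivrMr//; nra.
Qed.
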